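(* Let $E$ be a holomorphic vector bundle on $X$, and take $$\Theta\in H^0(X,\,\mathrm{End}(E)\otimes\mathcal{S}),\qquad \Theta'\in H^0(X,\,\mathrm{End}(E)\otimes\mathcal{L}).$$ Let $\varphi:Y\to X$ be the spectral curve of $(E,\Theta)$ and $F\subset\varphi^*E$ the associated sheaf. Suppose that the following three conditions hold: (1) The homomorphism $\varphi^*\Theta':\varphi^*E\to(\varphi^*E)\otimes\varphi^*\mathcal{L}$ sends the subsheaf $F$ into $F\otimes\varphi^*\mathcal{L}\subset(\varphi^*E)\otimes\varphi^*\mathcal{L}$. (2) The homomorphisms $(\varphi^*\Theta)|_F:F\to F\otimes\varphi^*\mathcal{S}$ and $(\varphi^*\Theta')|_F:F\to F\otimes\varphi^*\mathcal{L}$ commute, that is, $$\big((\varphi^*\Theta')|_F\otimes\mathrm{Id}_{\varphi^*\mathcal{S}}\big)\circ(\varphi^*\Theta)|_F=\big((\varphi^*\Theta)|_F\otimes\mathrm{Id}_{\varphi^*\mathcal{L}}\big)\circ(\varphi^*\Theta')|_F$$ as homomorphisms from $F$ to $F\otimes\varphi^*(\mathcal{S}\otimes\mathcal{L})$. (3) For every $x\in D$ and every connected component $y$ of $\varphi^{-1}(x)$, with $\Theta_y:F_y\to F_y\otimes\mathcal{S}_x$ and $\Theta'_y:F_y\to F_y\otimes\mathcal{L}_x$ the homomorphisms induced by $\Theta(x)$ and $\Theta'(x)$, $$(\mathrm{Id}_{F_y}\otimes\xi_{1,x})\circ\Theta_y+(\mathrm{Id}_{F_y}\otimes\xi_{2,x})\circ\Theta'_y=0$$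 as homomorphisms $F_y\to F_y\otimes\mathbb{T}_x$. Then there is a unique $V$-twisted Higgs field $\theta$ on $E$ such that $\Theta=(\mathrm{Id}\otimes\widehat\rho_1)(\theta)$ and $\Theta'=(\mathrm{Id}\otimes\widehat\rho_2)(\theta)$.
   Context: Setting. $X$ is a compact connected Riemann surface and $V$ is a holomorphic vector bundle of rank two on $X$. $\mathcal{S},\mathcal{L}$ are holomorphic line bundles on $X$, $D=\sum_{i=1}^{\ell}x_i$ is a reduced effective divisor (also regarded as a finite set of points), and there is a fixed short exact sequence of $\mathcal{O}_X$-modules $$0\to V\xrightarrow{\Phi}\mathcal{S}\oplus\mathcal{L}\xrightarrow{\xi}\mathbb{T}\to 0,$$ where $\mathbb{T}$ is a torsion sheaf with support $D$ and of length one at each point of $D$, such that for every $x\in D$ the induced maps $\xi_{1,x}:\mathcal{S}_x\to\mathbb{T}_x$ and $\xi_{2,x}:\mathcal{L}_x\to\mathbb{T}_x$ on fibers are injective (hence isomorphisms of one-dimensional spaces). Let $\widehat\rho_1:V\to\mathcal{S}$ and $\widehat\rho_2:V\to\mathcal{L}$ be the compositions of $\Phi$ with the two projections. Twisted Higgs fields. A $V$-twisted Higgs field on a holomorphic vector bundle $E$ is a section $\theta\in H^0(X,\mathrm{End}(E)\otimes V)$ with $\theta\wedge\theta=0$ in $H^0(X,\mathrm{End}(E)\otimes\bigwedge^2V)$ (locally, if $\theta=\sum_i A_i\otimes v_i$ then $\theta\wedge\theta=\sum_{i,j}A_iA_j\otimes v_i\wedge v_j$). For a line bundle $\mathcal{N}$,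 an $\mathcal{N}$-twisted Higgs field is a section of $\mathrm{End}(E)\otimes\mathcal{N}$, regarded also as a homomorphism $E\to E\otimes\mathcal{N}$. Spectral data. Given $\Theta\in H^0(X,\mathrm{End}(E)\otimes\mathcal{S})$ with $E$ of rank $r$, let $\phi:\mathcal{S}\to X$ be the projection from the total space of $\mathcal{S}$ and $t$ the tautological section of $\phi^*\mathcal{S}$. The spectral curve $Y\subset\mathcal{S}$ is the closed subscheme defined by the characteristic polynomial $t^r-\phi^*s_1t^{r-1}+\cdots+(-1)^r\phi^*s_r=0$, $s_i=\mathrm{tr}(\bigwedge^i\Theta)$, and $\varphi=\phi|_Y:Y\to X$. The associated sheaf is $F=\ker\big(\varphi^*\Theta-t\cdot\mathrm{Id}:\varphi^*E\to\varphi^*E\otimes\varphi^*\mathcal{S}\big)\subset\varphi^*E$, and it is preserved by $\varphi^*\Theta$. For $x\in X$ and a connected component $y$ of the scheme $\varphi^{-1}(x)$, $y_{\rm red}$ is a single point of the fiber $\mathcal{S}_x$, and it is an eigenvalue of $\Theta(x):E_x\to E_x\otimes\mathcal{S}_x$; $F_y\subset E_x$ denotes the generalized eigenspace of $\Theta(x)$ for the eigenvalue $y_{\rm red}$. It is preserved by $\Theta(x)$; when condition (1) holds, it is also preserved by $\Theta'(x)$ (i.e. $\Theta'(x)(F_y)\subset F_y\otimes\mathcal{L}_x$). *)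

(* Defs.v *)
From HB Require Import structures.
From mathcomp Require Import all_boot all_order all_algebra.
From mathcomp Require Import all_classical all_reals all_analysis.
From mathcomp Require Import complex.

Set Implicit Arguments.
Unset Strict Implicit.
Unset Printing Implicit Defensive.

Import Order.TTheory GRing.Theory Num.Theory.
Import numFieldNormedType.Exports.

Local Open Scope classical_set_scope.
Local Open Scope ring_scope.

(* R[i] with its numClosedFieldType structure made explicit, so that the      *)
(* normed topology of numFieldNormedType is inferred on it.                   *)
Definition Cplx (R : realType) : numClosedFieldType := complex R.

(** * Tensor products of finite-dimensional vector spaces *)

Section Tensor.
Variable C : fieldType.
Implicit Types U W Z : vectType C.

(* U (x) W is realised by matrices of coordinates in the bases vbasis {:U}    *)
(* and vbasis {:W}; tlift_pure and tlift_uniq are its universal property.     *)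
Definition tens U W : vectType C := 'M[C]_(\dim {:U}, \dim {:W}).

Definition pure U W (u : U) (w : W) : tens U W :=
  \matrix_(i, j) (coord (vbasis {:U}) i u * coord (vbasis {:W}) j w).

Definition tlift U W Z (b : U -> W -> Z) (m : tens U W) : Z :=
  \sum_i \sum_j m i j *: b (vbasis {:U})`_i (vbasis {:W})`_j.

Definition bilin U W Z (b : U -> W -> Z) : Prop :=
  (forall w, linear (b^~ w)) /\ (forall u, linear (b u)).

Lemma tlift_pure U W Z (b : U -> W -> Z) (u : U) (w : W) :
  bilin b -> tlift b (pure u w) = b u w.
Proof.
move=> [bl br].
have bl0 w' : b 0 w' = 0 by have := bl w' (-1) 0 0; rewrite !scaleN1r !addNr.
have br0 u' : b u' 0 = 0 by have := br u' (-1) 0 0; rewrite !scaleN1r !addNr.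
have blS w' n (F : 'I_n -> U) (a : 'I_n -> C) :
    b (\sum_i a i *: F i) w' = \sum_i a i *: b (F i) w'.
  elim: n F a => [|n IH] F a; first by rewrite !big_ord0.
  by rewrite !big_ord_recl bl IH.
have brS u' n (F : 'I_n -> W) (a : 'I_n -> C) :
    b u' (\sum_i a i *: F i) = \sum_i a i *: b u' (F i).
  elim: n F a => [|n IH] F a; first by rewrite !big_ord0.
  by rewrite !big_ord_recl br IH.
rewrite [in RHS](coord_vbasis (memvf u)) blS.
apply: eq_bigr => i _; rewrite [in RHS](coord_vbasis (memvf w)) brS scaler_sumr.
by apply: eq_bigr => j _; rewrite mxE scalerA.
Qed.

Lemma tlift_linear U W Z (b : U -> W -> Z) : linear (tlift b).
Proof.
move=> a m n; rewrite /tlift scaler_sumr -big_split; apply: eq_bigr => i _.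
rewrite scaler_sumr -big_split; apply: eq_bigr => j _.
by rewrite !mxE scalerDl scalerA.
Qed.

Lemma pure_bilin U W : bilin (@pure U W).
Proof.
split=> [w|u] a x y; apply/matrixP=> i j; rewrite !mxE linearP /=.
  by rewrite mulrDl mulrA.
by rewrite mulrDr mulrCA.
Qed.

Lemma tlift_uniq U W Z (b : U -> W -> Z) (f : tens U W -> Z) :
  linear f -> (forall u w, f (pure u w) = b u w) -> f =1 tlift b.
Proof.
move=> lf fb m.
have f0 : f 0 = 0 by have := lf (-1) 0 0; rewrite !scaleN1r !addNr.
have fS n (F : 'I_n -> tens U W) : f (\sum_i F i) = \sum_i f (F i).
  elim: n F => [|n IH] F; first by rewrite !big_ord0.
  by rewrite !big_ord_recl -IH -[in LHS](scale1r (F ord0)) lf scale1r.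
have -> : f m = f (\sum_i \sum_j (m i j *: (delta_mx i j : tens U W))).
  by congr f; exact: matrix_sum_delta.
rewrite /tlift fS; apply: eq_bigr => i _.
rewrite fS; apply: eq_bigr => j _.
rewrite -[X in f X]addr0 lf f0 addr0 -fb; congr (_ *: f _).
apply/matrixP=> i' j'; rewrite !mxE.
rewrite !(coord_free _ _ (basis_free (vbasisP _))).
by rewrite -natrM mulnb [i' == i]eq_sym [j' == j]eq_sym.
Qed.

Definition tmap U U' W W' (f : 'Hom(U, U')) (g : 'Hom(W, W')) :
    tens U W -> tens U' W' :=
  tlift (fun u w => pure (f u) (g w)).

(* Id (x) lam : U (x) W -> U for a linear form lam on W. *)
Definition contract U W (lam : W -> C) : tens U W -> U :=
  tlift (fun u w => lam w *: u).

(* An element of End(U) (x) W seen as a homomorphism U -> U (x) W. *)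
Definition twact U W (t : tens 'End(U) W) (u : U) : tens U W :=
  tlift (fun (A : 'End(U)) w => pure (A u) w) t.

(* For m in U (x) W1 and t in End(U) (x) W2, the element (t (x) Id_{W1})(m)   *)
(* of U (x) (W1 (x) W2), resp. of U (x) (W2 (x) W1): the two versions put the *)
(* two twisting factors in a prescribed order, so that a product of Theta     *)
(* and Theta' in either order has values in the same space.                   *)
Definition twactl U W1 W2 (t : tens 'End(U) W2) : tens U W1 -> tens U (tens W1 W2) :=
  tlift (fun u w1 => tlift (fun u' w2 => pure u' (pure w1 w2)) (twact t u)).
Definition twactr U W1 W2 (t : tens 'End(U) W2) : tens U W1 -> tens U (tens W2 W1) :=
  tlift (fun u w1 => tlift (fun u' w2 => pure u' (pure w2 w1)) (twact t u)).

(* In characteristic 0 the exterior square is the space of antisymmetric      *)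
(* tensors, with the following wedge product.                                 *)
Definition wedge W (v w : W) : tens W W := pure v w - pure w v.

(* (sum_i A_i (x) v_i) /\ (sum_j A_j (x) v_j) = sum_ij A_i A_j (x) v_i /\ v_j *)
Definition twwedge U W (t : tens 'End(U) W) : tens 'End(U) (tens W W) :=
  tlift (fun (A : 'End(U)) v =>
    tlift (fun (B : 'End(U)) w => pure (A \o B)%VF (wedge v w)) t) t.

Definition endo_mx U (f : 'End(U)) : 'M[C]_(\dim {:U}) :=
  \matrix_(i, j) coord (vbasis {:U}) j (f (vbasis {:U})`_i).

End Tensor.

(** * Riemann surfaces and holomorphic functions *)

(* rs_inv i is the inverse of the chart rs_chart i : rs_dom i -> C; the       *)
(* values of rs_chart i and rs_inv i elsewhere are irrelevant.                *)
Record riemann_surface (R : realType) := RiemannSurface {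
  rs_space :> topologicalType;
  rs_index : Type;
  rs_dom : rs_index -> set rs_space;
  rs_chart : rs_index -> rs_space -> Cplx R;
  rs_inv : rs_index -> Cplx R -> rs_space;
  rs_hausdorff : hausdorff_space rs_space;
  rs_cover : forall x, exists i, rs_dom i x;
  rs_dom_open : forall i, open (rs_dom i);
  rs_img_open : forall i, open (rs_chart i @` rs_dom i);
  rs_chartK : forall i x, rs_dom i x -> rs_inv i (rs_chart i x) = x;
  rs_chart_cts : forall i x, rs_dom i x -> {for x, continuous (rs_chart i)};
  rs_inv_cts : forall i x, rs_dom i x ->
    {for rs_chart i x, continuous (rs_inv i)};
  rs_transition : forall i j x, rs_dom i x -> rs_dom j x ->
    derivable (rs_chart j \o rs_inv i) (rs_chart i x) 1
}.

Section Sheaves.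
Variables (R : realType) (X : riemann_surface R).
Local Notation C := (Cplx R).

(* f is holomorphic in a neighbourhood of x *)
Definition holo_at (x : X) (f : X -> C) : Prop :=
  forall i, rs_dom i x ->
    \forall z \near rs_chart i x, derivable (f \o rs_inv i) z 1.

(** * Sheaves of sections of families of vector spaces *)

(* A sheaf of O_X-modules whose sections are families of vectors:             *)
(* sec x s says that the restriction of s to some neighbourhood of x is a     *)
(* section of the sheaf.                                                      *)
Record osheaf := OSheaf {
  fib :> X -> vectType C;
  sec : forall x : X, (forall y : X, fib y) -> Prop
}.

Definition global_section (A : osheaf) (s : forall x, A x) : Prop :=
  forall x, sec x s.

(* A holomorphic vector bundle of rank r: near each point x0 there are r      *)
(* families of vectors e_i which are pointwise bases and such that the        *)
(* holomorphic sections are exactly the families whose coordinates in e are   *)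
(* holomorphic.                                                               *)
Definition vector_bundle (r : nat) (A : osheaf) : Prop :=
  forall x0 : X, exists e : 'I_r -> forall x, A x,
    \forall x \near x0,
      basis_of {:A x} [tuple e i x | i < r] /\
      forall s : forall y, A y, sec x s <->
        forall i, holo_at x (fun y => coord [tuple e j y | j < r] i (s y)).

Definition dsum (A B : osheaf) : osheaf := @OSheaf (fun x => (A x * B x)%type)
  (fun x s => sec x (fun y => (s y).1) /\ sec x (fun y => (s y).2)).

Definition tensor (A B : osheaf) : osheaf := @OSheaf (fun x => tens (A x) (B x))
  (fun x s => exists (n : nat) (a : 'I_n -> forall y, A y) (b : 'I_n -> forall y, B y),
    [/\ forall i, sec x (a i), forall i, sec x (b i) &
      \forall y \near x, s y = \sum_i pure (a i y) (b i y)]).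

Definition endo (A : osheaf) : osheaf := @OSheaf (fun x => 'End(A x))
  (fun x f => forall s, sec x s -> sec x (fun y => f y (s y))).

(* The direct sum of the skyscraper sheaves with stalk T x at x in D, where   *)
(* functions act on T x through their value at x.  A torsion sheaf with       *)
(* support D and of length one at each point of D is of this form, since its  *)
(* stalk at x in D is a simple module over the local ring of X at x.          *)
Definition torsion_length_one (D : set X) (T : osheaf) : Prop :=
  [/\ forall x, D x -> \dim {:T x} = 1%N,
      forall x, ~ D x -> \dim {:T x} = 0%N
    & forall x (s : forall y, T y), sec x s].

Definition morphism (A B : osheaf) (f : forall x, 'Hom(A x, B x)) : Prop :=
  forall x s, sec x s -> sec x (fun y => f y (s y)).

(* Exactness of 0 -> A -> B -> Q -> 0 on stalks *)
Definition short_exact (A B Q : osheaf)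
    (f : forall x, 'Hom(A x, B x)) (g : forall x, 'Hom(B x, Q x)) : Prop :=
  [/\ morphism f, morphism g,
    forall x s, sec x s ->
      (\forall y \near x, f y (s y) = 0) -> \forall y \near x, s y = 0,
    forall x s, sec x s ->
      (\forall y \near x, g y (s y) = 0) <->
      exists2 a, sec x a & \forall y \near x, f y (a y) = s y
  & forall x q, sec x q ->
      exists2 s, sec x s & \forall y \near x, g y (s y) = q y].

Section Components.
Variables (A B1 B2 Q : osheaf).

Definition rho1 (f : forall x, 'Hom(A x, dsum B1 B2 x)) x : 'Hom(A x, B1 x) :=
  linfun (fun a => (f x a).1).
Definition rho2 (f : forall x, 'Hom(A x, dsum B1 B2 x)) x : 'Hom(A x, B2 x) :=
  linfun (fun a => (f x a).2).
Definition xi1 (g : forall x, 'Hom(dsum B1 B2 x, Q x)) x : 'Hom(B1 x, Q x) :=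
  linfun (fun b => g x (b, 0)).
Definition xi2 (g : forall x, 'Hom(dsum B1 B2 x, Q x)) x : 'Hom(B2 x, Q x) :=
  linfun (fun b => g x (0, b)).

End Components.

Definition higgs_field (E V : osheaf) (theta : forall x, tensor (endo E) V x) : Prop :=
  global_section theta /\ forall x, twwedge (theta x) = 0.

(** * The total space of a line bundle and the spectral curve *)

Section Spectral.
Variable S : osheaf.

Definition total : Type := {x : X & S x}.

(* The pair (i, sigma) of a chart of X and a nonvanishing local section of S  *)
(* parametrizes the total space near p by C x C, with (z, tau) going to the   *)
(* vector tau * sigma over the point with coordinate z.                       *)
Definition tot_point (i : rs_index X) (sigma : forall x, S x) (w : C * C) : total :=
  existT _ (rs_inv i w.1) (w.2 *: sigma (rs_inv i w.1)).

Definition tot_coord (p : total) i (sigma : forall x, S x) (tau : C) : Prop :=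
  [/\ rs_dom i (tag p), sec (tag p) sigma, sigma (tag p) != 0
    & tagged p = tau *: sigma (tag p)].

Definition tot_near (p : total) (P : total -> Prop) : Prop :=
  forall i sigma tau, tot_coord p i sigma tau ->
    \forall w \near (rs_chart i (tag p), tau), P (tot_point i sigma w).

Definition tot_holo (p : total) (g : total -> C) : Prop :=
  forall i sigma tau, tot_coord p i sigma tau ->
    \forall w \near (rs_chart i (tag p), tau), differentiable (g \o tot_point i sigma) w.

(* Sections near p of the pullback of A to the total space *)
Definition sec_pull (A : osheaf) (p : total) (u : forall q : total, A (tag q)) : Prop :=
  exists (n : nat) (g : 'I_n -> total -> C) (a : 'I_n -> forall x, A x),
    [/\ forall i, tot_holo p (g i), forall i, sec (tag p) (a i) &
      tot_near p (fun q => u q = \sum_i g i q *: a i (tag q))].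

Section Curve.
Variables (E : osheaf) (Theta : forall x, tensor (endo E) S x).

(* The value at p of det(t - Theta) = sum_i (-1)^i tr(/\^i Theta) t^(r-i), a  *)
(* section of the r-th power of S, in the trivialization of the fibre of S    *)
(* given by the linear form lam.                                              *)
Definition spec_poly (p : total) (lam : S (tag p) -> C) : C :=
  (char_poly (endo_mx (contract lam (Theta (tag p))))).[lam (tagged p)].

Definition on_spec (p : total) : Prop :=
  forall lam : 'Hom(S (tag p), C^o), lam != 0 -> spec_poly (p := p) lam = 0.

(* The local equation of the spectral curve in the trivialization of S        *)
(* by the nonvanishing local section sigma                                    *)
Definition spec_eq (sigma : forall x, S x) (p : total) : C :=
  spec_poly (p := p) (coord [tuple of [:: sigma (tag p)]] ord0).

(* The structure sheaf of the spectral curve Y at p is the quotient of the    *)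
(* ring of germs of holomorphic functions on the total space by the ideal of  *)
(* the local equation, so sections of phi^*A over Y are represented by        *)
(* sections over the total space, and zero_on_spec p u says that u represents *)
(* zero in the stalk of phi^*A on Y at p.                                     *)
Definition zero_on_spec (A : osheaf) (p : total) (u : forall q : total, A (tag q)) : Prop :=
  exists (sigma : forall x, S x) (h : forall q : total, A (tag q)),
    [/\ sec (tag p) sigma, sigma (tag p) != 0, sec_pull p h &
      tot_near p (fun q => u q = spec_eq sigma q *: h q)].

(* f represents an element of the stalk at p of F, the kernel on Y of         *)
(* phi^*Theta - t Id                                                          *)
Definition in_F (p : total) (f : forall q : total, E (tag q)) : Prop :=
  sec_pull p f /\
  zero_on_spec (A := tensor E S) p
    (fun q => twact (Theta (tag q)) (f q) - pure (f q) (tagged q)).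

(* u represents an element of the stalk at p of the subsheaf F (x) phi^*L     *)
(* of phi^*E (x) phi^*L                                                       *)
Definition in_F_tensor (L : osheaf) (p : total)
    (u : forall q : total, tensor E L (tag q)) : Prop :=
  exists (n : nat) (f : 'I_n -> forall q : total, E (tag q))
         (l : 'I_n -> forall q : total, L (tag q)),
    [/\ forall i, in_F p (f i), forall i, sec_pull p (l i) &
      zero_on_spec (A := tensor E L) p
        (fun q => u q - \sum_i pure (f i q) (l i q))].

Definition preserves_F (L : osheaf) (Theta' : forall x, tensor (endo E) L x) : Prop :=
  forall p, on_spec p -> forall f, in_F p f ->
    in_F_tensor (L := L) p (fun q => twact (Theta' (tag q)) (f q)).

Definition commute_on_F (L : osheaf) (Theta' : forall x, tensor (endo E) L x) : Prop :=
  forall p, on_spec p -> forall f, in_F p f ->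
    zero_on_spec (A := tensor E (tensor S L)) p
      (fun q => twactl (Theta' (tag q)) (twact (Theta (tag q)) (f q))
              - twactr (Theta (tag q)) (twact (Theta' (tag q)) (f q))).

(* For y = (x, mu) in the spectral curve, gen_eigen y e says that e belongs   *)
(* to the generalized eigenspace F_y of Theta(x) for the eigenvalue mu in     *)
(* S_x, the identification of S_x with C being made by linear forms lam.      *)
Definition gen_eigen (y : total) (e : E (tag y)) : Prop :=
  forall lam : 'Hom(S (tag y), C^o), exists k : nat,
    iter k (fun v => contract lam (Theta (tag y)) v - (lam (tagged y) : C) *: v) e = 0.

Definition residue_condition (L T : osheaf) (D : set X)
    (Theta' : forall x, tensor (endo E) L x)
    (f1 : forall x, 'Hom(S x, T x)) (f2 : forall x, 'Hom(L x, T x)) : Prop :=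
  forall y, D (tag y) -> on_spec y -> forall e, gen_eigen (y := y) e ->
    tmap \1%VF (f1 (tag y)) (twact (Theta (tag y)) e) +
    tmap \1%VF (f2 (tag y)) (twact (Theta' (tag y)) e) = 0.

End Curve.
End Spectral.
End Sheaves.

(* Main.v *)
Require Import Defs.
From HB Require Import structures.
From mathcomp Require Import all_boot all_order all_algebra.
From mathcomp Require Import all_classical all_reals all_analysis.
From mathcomp Require Import complex.

Set Implicit Arguments.
Unset Strict Implicit.
Unset Printing Implicit Defensive.

Import Order.TTheory GRing.Theory Num.Theory.
Import numFieldNormedType.Exports.

Local Open Scope classical_set_scope.
Local Open Scope ring_scope.

(** Off the finite set D the fibre maps of Phi are invertible, so the pair
    (Theta, Theta') has exactly one preimage theta there; in terms of local
    generators s of S and l of L, with Theta = A (x) s and Theta' = A' (x) l, the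
    section theta /\ theta is the commutator of A and A' tensored with the wedge
    of the preimages of s and l.  The proof thus has three parts.

    - A and A' commute ([commute_at]).  Let M and M' be their matrices in a local
      frame of E, and t the fibre coordinate of the total space of S.  Since
      (t - M) adj(t - M) = det(t - M), the vectors c adj(t - M) are sections of
      the kernel sheaf F ([kernel_section_in_F]).  Commutation on F says that
      adj(t - M) (M M' - M' M) is locally a multiple of the equation det(t - M)
      of the spectral curve.  On the fibre over a fixed point both sides are
      polynomials in t, and a continuous quotient near every root of the
      characteristic polynomial is enough for divisibility
      ([dvdp_of_local_quotients]).  The entries of adj(t - M) have degree less
      than r, hence the product vanishes, and with it the commutator
      ([adj_char_poly_dvd_eq0]).

    - A lift exists near each point of D.  The generalized eigenspaces of Theta(x)
      span E_x ([gen_eigen_span]), so the residue condition on each of them says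
      that xi annihilates the pair (M_ij s, M'_ij l) for all i and j
      ([residue_entries]).  By exactness this pair lifts to a section a_ij of V,
      and the sum of the e_ij (x) a_ij, with e_ij the elementary endomorphisms of
      the frame, is a local lift of (Theta, Theta') ([local_lift]).

    - Local lifts agree off D, hence glue ([lift_exists]).  A holomorphic function
      that vanishes on a punctured neighbourhood vanishes at the centre
      ([holo_vanish]); this carries uniqueness and theta /\ theta = 0 from the
      complement of D to X ([lift_unique], [lift_wedge]). *)

(** * Tensors and the maps defined on them *)

Section TensorAlgebra.
Variable C : fieldType.
Implicit Types U W Z : vectType C.

(* The maps given by the universal property of tens are bare functions with a
   proof of linearity, hence this calculus for them. *)
Section Linear.
Variables (U Z : vectType C) (f : U -> Z).
Hypothesis lf : linear f.
Lemma lin0 : f 0 = 0. Proof. by have := lf (-1) 0 0; rewrite !scaleN1r !addNr. Qed.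
Lemma linD u v : f (u + v) = f u + f v.
Proof. by rewrite -[u in LHS]scale1r lf scale1r. Qed.
Lemma linZ a u : f (a *: u) = a *: f u.
Proof. by rewrite -[in LHS](addr0 (a *: u)) lf lin0 addr0. Qed.
Lemma linB u v : f (u - v) = f u - f v.
Proof. by rewrite linD -scaleN1r linZ scaleN1r. Qed.
Lemma linS (I : Type) (s : seq I) (P : pred I) (F : I -> U) :
  f (\sum_(i <- s | P i) F i) = \sum_(i <- s | P i) f (F i).
Proof.
by apply: (big_morph f) => [u v|]; [rewrite linD | rewrite lin0].
Qed.
End Linear.

(** Both maps solve the same universal problem, so it suffices to compare them on
    pure tensors; most identities below are proved this way. *)
Lemma tens_ext U W Z (f g : tens U W -> Z) : linear f -> linear g ->
  (forall u w, f (pure u w) = g (pure u w)) -> f =1 g.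
Proof.
move=> lf lg fg t.
rewrite (tlift_uniq (b := fun u w => g (pure u w)) lf fg).
by rewrite (tlift_uniq (b := fun u w => g (pure u w)) lg).
Qed.

Lemma pureDl U W (w : W) : linear (fun u : U => pure u w).
Proof. exact: (pure_bilin U W).1. Qed.
Lemma pureDr U W (u : U) : linear (fun w : W => pure u w).
Proof. exact: (pure_bilin U W).2. Qed.

Lemma contract_linear U W (lam : W -> C) : linear (@Defs.contract C U W lam).
Proof. exact: tlift_linear. Qed.

Lemma contractE U W (lam : W -> C) (u : U) w : linear (lam : W -> C^o) ->
  Defs.contract lam (pure u w) = lam w *: u.
Proof.
move=> ll; apply: tlift_pure; split=> [w'|u'] a x y.
  by rewrite scalerDr !scalerA mulrC.
by rewrite ll scalerDl scalerA.
Qed.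

(** The mirror image of [Defs.contract], with the linear form on the first
    factor. *)
Definition cocontract U W (phi : U -> C) : tens U W -> W :=
  tlift (fun u w => phi u *: w).

Lemma cocontract_linear U W (phi : U -> C) : linear (@cocontract U W phi).
Proof. exact: tlift_linear. Qed.

Lemma cocontractE U W (phi : U -> C) (u : U) (w : W) : linear (phi : U -> C^o) ->
  cocontract phi (pure u w) = phi u *: w.
Proof.
move=> ll; apply: tlift_pure; split=> [w'|u'] a x y.
  by rewrite ll scalerDl scalerA.
by rewrite scalerDr !scalerA mulrC.
Qed.

Lemma coord_linear U n (b : n.-tuple U) i : linear (coord b i : U -> C^o).
Proof. by move=> a x y; rewrite linearP. Qed.

Lemma tmap_linear U U' W W' (f : 'Hom(U, U')) (g : 'Hom(W, W')) : linear (tmap f g).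
Proof. exact: tlift_linear. Qed.

Lemma tmapE U U' W W' (f : 'Hom(U, U')) (g : 'Hom(W, W')) u w :
  tmap f g (pure u w) = pure (f u) (g w).
Proof.
apply: tlift_pure; split=> [w'|u'] a x y; rewrite linearP; first exact: pureDl.
exact: pureDr.
Qed.

Lemma twactE U W (A : 'End(U)) (w : W) u : twact (pure A w) u = pure (A u) w.
Proof.
apply: (tlift_pure A w (b := fun (A : 'End(U)) w => pure (A u) w)).
split=> [w'|A'] a x y; first by rewrite add_lfunE scale_lfunE; exact: pureDl.
exact: pureDr.
Qed.

Lemma twactlE U W1 W2 (A : 'End(U)) (w2 : W2) u (w1 : W1) :
  twactl (pure A w2) (pure u w1) = pure (A u) (pure w1 w2).
Proof.
have E u' w1' : tlift (fun u' w2 => pure u' (pure w1' w2)) (twact (pure A w2) u') =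
    pure (A u') (pure w1' w2).
  rewrite twactE.
  apply: (tlift_pure (A u') w2 (b := fun u' w2 => pure u' (pure w1' w2))).
  split=> [w|v] a x y; first exact: pureDl.
  by rewrite pureDr; exact: pureDr.
rewrite /twactl.
under [X in tlift X]eq_fun do under eq_fun do rewrite E.
apply: (tlift_pure u w1 (b := fun u w1 => pure (A u) (pure w1 w2))).
split=> [w|v] a x y; first by rewrite linearP; exact: pureDl.
by rewrite pureDl; exact: pureDr.
Qed.

Lemma twactrE U W1 W2 (A : 'End(U)) (w2 : W2) u (w1 : W1) :
  twactr (pure A w2) (pure u w1) = pure (A u) (pure w2 w1).
Proof.
have E u' w1' : tlift (fun u' w2 => pure u' (pure w2 w1')) (twact (pure A w2) u') =
    pure (A u') (pure w2 w1').
  rewrite twactE.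
  apply: (tlift_pure (A u') w2 (b := fun u' w2 => pure u' (pure w2 w1'))).
  split=> [w|v] a x y; first exact: pureDl.
  by rewrite pureDl; exact: pureDr.
rewrite /twactr.
under [X in tlift X]eq_fun do under eq_fun do rewrite E.
apply: (tlift_pure u w1 (b := fun u w1 => pure (A u) (pure w2 w1))).
split=> [w|v] a x y; first by rewrite linearP; exact: pureDl.
by rewrite pureDr; exact: pureDr.
Qed.

Lemma basis_coord U n (b : n.-tuple U) u : basis_of {:U} b ->
  u = \sum_i coord b i u *: b`_i.
Proof. by move=> bb; exact: (coord_basis bb (memvf u)). Qed.

Lemma tens_basis U W n (w : n.-tuple W) (t : tens U W) : basis_of {:W} w ->
  t = \sum_l pure (Defs.contract (coord w l) t) w`_l.
Proof.
move=> bw; apply: (tens_ext (f := id)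
  (g := fun t => \sum_l pure (Defs.contract (coord w l) t) w`_l)) => [//|a x y|u v].
  rewrite scaler_sumr -big_split; apply: eq_bigr => l _.
  by rewrite contract_linear pureDl.
under eq_bigr => l _ do rewrite (contractE _ _ (@coord_linear _ _ _ _)).
rewrite [in LHS](basis_coord v bw) (linS (pureDr u)).
apply: eq_bigr => l _.
by rewrite (linZ (pureDr u)) (linZ (pureDl _)).
Qed.

Lemma wedge_linear W (v : W) : linear (Defs.wedge v).
Proof.
move=> a x y; rewrite /Defs.wedge pureDr pureDl scalerBr opprD !addrA; congr (_ - _).
by rewrite -!addrA; congr (_ + _); rewrite addrC.
Qed.

Lemma wedgeC W (v w : W) : Defs.wedge v w = - Defs.wedge w v.
Proof. by rewrite /Defs.wedge opprB. Qed.

Lemma wedge_linearl W (w : W) : linear (fun v : W => Defs.wedge v w).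
Proof. by move=> a x y; rewrite wedgeC wedge_linear opprD -scalerN -!wedgeC. Qed.

(** The square of a tensor is quadratic in it, so its expansion on a sum of pure
    tensors is obtained from the inner variable first. *)
Lemma twwedge_sum U W n (B : 'I_n -> 'End(U)) (v : 'I_n -> W) :
  twwedge (\sum_l pure (B l) (v l)) =
  \sum_l \sum_m pure (B l \o B m)%VF (Defs.wedge (v l) (v m)).
Proof.
have inner (A : 'End(U)) w :
    tlift (fun (B : 'End(U)) w' => pure (A \o B)%VF (Defs.wedge w w')) (\sum_m pure (B m) (v m)) =
    \sum_m pure (A \o B m)%VF (Defs.wedge w (v m)).
  rewrite (linS (@tlift_linear _ _ _ _ _)); apply: eq_bigr => m _.
  apply: (tlift_pure (B m) (v m)
    (b := fun (B : 'End(U)) w' => pure (A \o B)%VF (Defs.wedge w w'))).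
  split=> [w'|B'] a x y.
    by rewrite comp_lfunDr -comp_lfunZr; exact: pureDl.
  by rewrite wedge_linear; exact: pureDr.
rewrite /twwedge.
under [X in tlift X]eq_fun do under eq_fun do rewrite inner.
rewrite (linS (@tlift_linear _ _ _ _ _)); apply: eq_bigr => l _.
apply: (tlift_pure (B l) (v l)
  (b := fun (A : 'End(U)) w => \sum_m pure (A \o B m)%VF (Defs.wedge w (v m)))).
split=> [w'|B'] a x y; rewrite scaler_sumr -big_split; apply: eq_bigr => m _ /=.
  by rewrite comp_lfunDl -comp_lfunZl; exact: pureDl.
by rewrite wedge_linearl; exact: pureDr.
Qed.

(** The diagonal terms vanish because v /\ v = 0, and the two mixed terms combine
    into a commutator because the wedge is antisymmetric. *)
Lemma twwedge2 U W (B0 B1 : 'End(U)) (v0 v1 : W) :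
  twwedge (pure B0 v0 + pure B1 v1) =
  pure ((B0 \o B1)%VF - (B1 \o B0)%VF) (Defs.wedge v0 v1).
Proof.
have := @twwedge_sum U W 2 (fun i => if i == ord0 then B0 else B1)
  (fun i => if i == ord0 then v0 else v1).
rewrite !big_ord_recl !big_ord0 /= !addr0 => ->.
have wvv (v : W) : Defs.wedge v v = 0 by exact: subrr.
rewrite !wvv !(lin0 (pureDr _)) add0r addr0 (wedgeC v1 v0).
by rewrite -scaleN1r (linZ (pureDr _)) scaleN1r (linB (pureDl _)).
Qed.

(** The linear form [lam] stands for the assumption that [w] is nonzero. *)
Lemma pure_eq0 U W (u : U) (w : W) (lam : W -> C) : linear (lam : W -> C^o) ->
  lam w = 1 -> pure u w = 0 -> u = 0.
Proof.
move=> ll lw /(congr1 (Defs.contract lam)).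
by rewrite contractE // lw scale1r (lin0 (@contract_linear _ _ _)).
Qed.

End TensorAlgebra.

(** * Matrices of endomorphisms *)
Section Frames.
Variable C : fieldType.
Variable U : vectType C.

(** Row convention: coordinates are row vectors and endomorphisms act on them from
    the right, as in [endo_mx]; composition is therefore reversed. *)
Definition endo_mx_in n (b : n.-tuple U) (A : 'End(U)) : 'M[C]_n :=
  \matrix_(i, j) coord b j (A b`_i).
Definition vec_in n (b : n.-tuple U) (c : 'rV[C]_n) : U := \sum_i c 0 i *: b`_i.

Lemma vec_in_linear n (b : n.-tuple U) : linear (vec_in b).
Proof.
move=> a x y; rewrite /vec_in scaler_sumr -big_split; apply: eq_bigr => i _ /=.
by rewrite !mxE scalerDl scalerA.
Qed.

Lemma coord_vec_in n (b : n.-tuple U) c j : basis_of {:U} b ->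
  coord b j (vec_in b c) = c 0 j.
Proof. by move=> bb; rewrite /vec_in coord_sum_free // (basis_free bb). Qed.

Lemma vec_inK n (b : n.-tuple U) u : basis_of {:U} b ->
  vec_in b (\row_j coord b j u) = u.
Proof.
by move=> bb; rewrite [RHS](basis_coord u bb); apply: eq_bigr => i _; rewrite mxE.
Qed.

Lemma endo_vec_in n (b : n.-tuple U) (A : 'End(U)) c : basis_of {:U} b ->
  A (vec_in b c) = vec_in b (c *m endo_mx_in b A).
Proof.
move=> bb; rewrite /vec_in linear_sum /=.
under eq_bigr => i _ do rewrite linearZ /= (basis_coord (A b`_i) bb) scaler_sumr.
rewrite exchange_big /=; apply: eq_bigr => j _; rewrite mxE scaler_suml.
by apply: eq_bigr => i _; rewrite mxE scalerA.
Qed.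

Lemma endo_mx_in_eq0 n (b : n.-tuple U) (A : 'End(U)) : basis_of {:U} b ->
  endo_mx_in b A = 0 -> A = 0.
Proof.
move=> bb A0; apply/lfunP => u; rewrite -(vec_inK u bb) endo_vec_in // A0 mulmx0 lfunE /=.
exact: lin0 (vec_in_linear b).
Qed.

Lemma endo_mx_in_linear n (b : n.-tuple U) : linear (endo_mx_in b).
Proof.
by move=> a x y; apply/matrixP=> i j; rewrite !mxE add_lfunE scale_lfunE linearP.
Qed.

Lemma endo_mx_in_comp n (b : n.-tuple U) (A B : 'End(U)) : basis_of {:U} b ->
  endo_mx_in b (A \o B)%VF = endo_mx_in b B *m endo_mx_in b A.
Proof.
move=> bb; apply/matrixP=> i j; rewrite !mxE comp_lfunE.
rewrite [in LHS](basis_coord (B b`_i) bb) !linear_sum /=; apply: eq_bigr => k _.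
by rewrite !linearZ /= !mxE.
Qed.

(** The sizes are kept distinct, since a frame of a bundle and the chosen basis of a
    fibre have sizes that are equal without being convertible. *)
Lemma det_conj n m (P : 'M[C]_(n, m)) (Q : 'M[C]_(m, n)) (M : 'M[C]_m) :
  P *m Q = 1%:M -> Q *m P = 1%:M -> \det (P *m M *m Q) = \det M.
Proof.
move=> PQ QP.
have nm : n = m.
  apply/eqP; rewrite eqn_leq; apply/andP; split.
    by rewrite -(mxrank1 C n) -PQ mulmx_max_rank.
  by rewrite -(mxrank1 C m) -QP mulmx_max_rank.
subst m; rewrite !det_mulmx mulrC mulrA -det_mulmx QP det1 mul1r //.
Qed.

(** The two matrices are conjugate by the change of basis. *)
Lemma det_endo_mx_in n m (b : n.-tuple U) (e : m.-tuple U) (A : 'End(U)) t :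
  basis_of {:U} b -> basis_of {:U} e ->
  \det (t%:M - endo_mx_in b A) = \det (t%:M - endo_mx_in e A).
Proof.
move=> bb be.
pose P : 'M[C]_(n, m) := \matrix_(i, j) coord e j b`_i.
pose Q : 'M[C]_(m, n) := \matrix_(i, j) coord b j e`_i.
have PQ : P *m Q = 1%:M.
  apply/matrixP=> i j; rewrite !mxE.
  rewrite -[RHS](coord_free _ _ (basis_free bb)).
  rewrite [in RHS](basis_coord b`_i be) linear_sum; apply: eq_bigr => k _.
  by rewrite !mxE linearZ.
have QP : Q *m P = 1%:M.
  apply/matrixP=> i j; rewrite !mxE.
  rewrite -[RHS](coord_free _ _ (basis_free be)).
  rewrite [in RHS](basis_coord e`_i bb) linear_sum; apply: eq_bigr => k _.
  by rewrite !mxE linearZ.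
suff -> : t%:M - endo_mx_in b A = P *m (t%:M - endo_mx_in e A) *m Q by exact: det_conj.
rewrite mulmxBr mulmxBl; congr (_ - _).
  by rewrite mul_mx_scalar -scalemxAl PQ scalemx1.
apply/matrixP=> i j; rewrite !mxE.
rewrite [in LHS](basis_coord b`_i be) !linear_sum.
under eq_bigr => k _ do
  rewrite !linearZ /= [in X in _ * X](basis_coord (A e`_k) be) linear_sum mulr_sumr.
rewrite exchange_big /=; apply: eq_bigr => l _.
rewrite !mxE mulr_suml; apply: eq_bigr => k _.
by rewrite !mxE !linearZ /= mulrA.
Qed.

Lemma char_poly_horner n (M : 'M[C]_n) t :
  (char_poly M).[t] = \det (t%:M - M).
Proof.
rewrite /char_poly -horner_evalE -det_map_mx; congr (\det _).
apply/matrixP=> i j.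
by rewrite !mxE /= /horner_eval hornerD hornerN hornerC hornerMn hornerX.
Qed.

Lemma endo_mxE (A : 'End(U)) : endo_mx A = endo_mx_in (vbasis {:U}) A.
Proof. by []. Qed.

End Frames.

Lemma nth_frame (K : fieldType) (U : vectType K) r (e : 'I_r -> U) (i : 'I_r) :
  [tuple e j | j < r]`_i = e i.
Proof. by rewrite nth_mktuple. Qed.

Lemma frame1_tuple (K : fieldType) (W : vectType K) (s : 'I_1 -> W) :
  [tuple s i | i < 1] = [tuple of [:: s ord0]].
Proof. by apply: eq_from_tnth => i; rewrite tnth_mktuple ord1. Qed.

Lemma endo_mx_in_contract (F : fieldType) (U W : vectType F) n (b : n.-tuple U) m
    (a : 'I_m -> 'End(U)) (w : 'I_m -> W) (lam : W -> F) i j :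
  linear (lam : W -> F^o) ->
  endo_mx_in b (Defs.contract lam (\sum_k pure (a k) (w k))) i j =
  \sum_k lam (w k) * endo_mx_in b (a k) i j.
Proof.
move=> ll.
rewrite (linS (@contract_linear _ _ _ _)) (linS (@endo_mx_in_linear _ _ _ _)) summxE.
apply: eq_bigr => k _; rewrite contractE //.
by rewrite (linZ (@endo_mx_in_linear _ _ _ _)) mxE.
Qed.

(** * Splittings and lifts of tensors *)
Section LinearMaps.
Variable K : fieldType.
Implicit Types U V W : vectType K.

Lemma linfunE U W (f : U -> W) : linear f -> linfun f =1 f.
Proof.
move=> lf; pose fL := GRing.isLinear.Build K U W *:%R f lf.
pose F : {linear U -> W} := HB.pack f fL.
exact: (lfunE F).
Qed.

Lemma dim_pair U W : \dim {:(U * W)%type} = (\dim {:U} + \dim {:W})%N.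
Proof. by rewrite !dimvf. Qed.

(** Rank-nullity. *)
Lemma surj_lker0 U W (f : 'Hom(U, W)) :
  \dim {:U} = \dim {:W} -> (forall w, exists u, f u = w) -> lker f == 0%VS.
Proof.
move=> dUW sf; rewrite -dimv_eq0.
have fW : (f @: fullv)%VS = fullv.
  apply/eqP; rewrite eqEsubv subvf /=; apply/subvP => w _.
  by have [u <-] := sf w; exact: memv_img (memvf u).
have := limg_ker_dim f fullv; rewrite fW capfv dUW => /eqP.
by rewrite -[X in _ == X]add0n eqn_add2r.
Qed.

(** If [g1], [g2] assemble to a left inverse of ([p1], [p2]), a tensor is recovered
    from its two projections; this expresses injectivity of the pair of
    projections and gives the preimage explicitly. *)
Lemma tens_split U V W1 W2 (p1 : 'Hom(V, W1)) (p2 : 'Hom(V, W2))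
    (g1 : 'Hom(W1, V)) (g2 : 'Hom(W2, V)) (t : tens U V) :
  (forall v, g1 (p1 v) + g2 (p2 v) = v) ->
  t = tmap \1%VF g1 (tmap \1%VF p1 t) + tmap \1%VF g2 (tmap \1%VF p2 t).
Proof.
move=> gp; apply: (tens_ext (f := id)
  (g := fun t => tmap \1%VF g1 (tmap \1%VF p1 t) + tmap \1%VF g2 (tmap \1%VF p2 t)))
  => [//|a x y|u v].
  by rewrite !tmap_linear scalerDr !addrA; congr (_ + _); rewrite addrAC.
by rewrite !tmapE !id_lfunE -(linD (pureDr u)) gp.
Qed.

(** In rank two there is a single basis wedge, so the square of a tensor is one
    commutator. *)
Lemma twwedge_frame U W (t : tens 'End(U) W) (v : 'I_2 -> W) :
  basis_of {:W} [tuple v i | i < 2] ->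
  let B k := Defs.contract (coord [tuple v i | i < 2] k) t in
  twwedge t = pure ((B ord0 \o B ord_max)%VF - (B ord_max \o B ord0)%VF)
                   (Defs.wedge (v ord0) (v ord_max)).
Proof.
move=> bv B; rewrite -twwedge2 [in LHS](tens_basis t bv) 2!big_ord_recl big_ord0 addr0.
have -> : lift ord0 ord0 = ord_max :> 'I_2 by exact: val_inj.
by rewrite !nth_frame.
Qed.

(** Contracting with the dual basis shows that the wedge of two basis vectors is not
    zero. *)
Lemma wedge_pure_eq0 U W (Z : 'End(U)) (v : 'I_2 -> W) :
  basis_of {:W} [tuple v i | i < 2] ->
  pure Z (Defs.wedge (v ord0) (v ord_max)) = 0 -> Z = 0.
Proof.
move=> bv; pose c i := coord [tuple v i | i < 2] i.
have cE i j : c i (v j) = (j == i)%:R.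
  by rewrite /c -(nth_frame v) coord_free // (basis_free bv).
apply: (pure_eq0 (lam := fun z => c ord0 (Defs.contract (c ord_max) z))).
  by move=> a x y; rewrite contract_linear; exact: coord_linear.
rewrite /Defs.wedge (linB (@contract_linear _ _ _ _)) !contractE; try exact: coord_linear.
by rewrite !cE /= scale1r scale0r subr0 cE.
Qed.

Section MatrixUnits.
Variables (U : vectType K) (r : nat) (b : r.-tuple U).

Definition endo_unit (i j : 'I_r) : 'End(U) := linfun (fun u => coord b i u *: b`_j).

Lemma endo_mx_in_unit i j : basis_of {:U} b ->
  endo_mx_in b (endo_unit i j) = delta_mx i j.
Proof.
move=> bb; apply/matrixP=> k l; rewrite !mxE linfunE; last first.
  by move=> a x y; rewrite linearP scalerDl scalerA.
rewrite linearZ /= !coord_free ?(basis_free bb) // /GRing.scale /= -natrM mulnb.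
by rewrite eq_sym [l == j]eq_sym.
Qed.

Lemma endo_mx_in_inj : basis_of {:U} b -> injective (endo_mx_in b).
Proof.
move=> bb A B AB; apply/eqP; rewrite -subr_eq0; apply/eqP; apply: (endo_mx_in_eq0 bb).
by rewrite (linB (endo_mx_in_linear b)) AB subrr.
Qed.

Lemma endo_unit_sum (A : 'End(U)) : basis_of {:U} b ->
  A = \sum_(ij : 'I_r * 'I_r) endo_mx_in b A ij.1 ij.2 *: endo_unit ij.1 ij.2.
Proof.
move=> bb; apply: (endo_mx_in_inj bb).
rewrite (linS (endo_mx_in_linear b)) [LHS]matrix_sum_delta.
rewrite pair_big; apply: eq_bigr => ij _.
by rewrite (linZ (endo_mx_in_linear b)) endo_mx_in_unit.
Qed.

(** The tensor whose (i, j) entry is the vector [a (i, j)].  The pairs are enumerated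
    by one ordinal because sections of a tensor product are sums over an ordinal. *)
Definition lift_tensor V (a : 'I_r * 'I_r -> V) : tens 'End(U) V :=
  \sum_(k < #|{: 'I_r * 'I_r}|)
     pure (endo_unit (enum_val k).1 (enum_val k).2) (a (enum_val k)).

Lemma tmap_lift_tensor V W (A : 'End(U)) (p : 'Hom(V, W)) (s : W)
    (a : 'I_r * 'I_r -> V) : basis_of {:U} b ->
  (forall ij, p (a ij) = endo_mx_in b A ij.1 ij.2 *: s) ->
  tmap \1%VF p (lift_tensor a) = pure A s.
Proof.
move=> bb pa; rewrite [in RHS](endo_unit_sum A bb) (linS (pureDl s)).
rewrite (linS (@tmap_linear _ _ _ _ _ _ _)).
rewrite -(big_enum_val (fun ij => tmap \1%VF p (pure (endo_unit ij.1 ij.2) (a ij)))).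
apply: eq_big => // ij _.
by rewrite tmapE id_lfunE pa (linZ (pureDr _)) (linZ (pureDl _)).
Qed.

End MatrixUnits.

End LinearMaps.

(** * The spectral equation over one point *)
Section SpectralAlgebra.
Variable K : fieldType.
Variables (U W : vectType K) (r : nat) (b : r.-tuple U) (s : W).
Hypothesis (bb : basis_of {:U} b) (bs : basis_of {:W} [tuple of [:: s]]).
Local Notation lam := (coord [tuple of [:: s]] ord0).

Lemma line_coord w : w = lam w *: s.
Proof. by rewrite [LHS](basis_coord w bs) big_ord1. Qed.

Lemma line_coord1 : lam s = 1.
Proof.
have := coord_free ord0 ord0 (basis_free bs); by rewrite eqxx.
Qed.

Lemma line_neq0 : s != 0.
Proof.
apply/eqP => /(congr1 (fun w => lam w)) /eqP; rewrite line_coord1 linear0.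
by rewrite oner_eq0.
Qed.

Lemma line_tens Z (t : tens Z W) : t = pure (Defs.contract lam t) s.
Proof. by rewrite [LHS](tens_basis t bs) big_ord1. Qed.

(** Replacing the coordinate given by [s] by another linear form multiplies both the
    variable and the endomorphism by [lam' s], hence the characteristic polynomial
    by its [r]-th power.  In particular the zero set of the spectral equation does
    not depend on the trivialization. *)
Lemma char_poly_line (t : tens 'End(U) W) (lam' : W -> K) (w : W) :
  linear (lam' : W -> K^o) ->
  (char_poly (endo_mx (Defs.contract lam' t))).[lam' w] =
  lam' s ^+ r * \det ((lam w)%:M - endo_mx_in b (Defs.contract lam t)).
Proof.
move=> ll; rewrite endo_mxE char_poly_horner (det_endo_mx_in _ _ (vbasisP _) bb).
have -> : lam' w = lam' s * lam w.
  by rewrite {1}(line_coord w) (linZ ll) mulrC.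
have -> : Defs.contract lam' t = lam' s *: Defs.contract lam t.
  by rewrite [in LHS](line_tens t) contractE.
rewrite (linZ (endo_mx_in_linear b)) -detZ; congr (\det _).
by rewrite scalerBr scale_scalar_mx.
Qed.

(** The identity adj(t - M) (t - M) = det(t - M): the left-hand side is what has to
    vanish on the spectral curve, the right-hand side is a multiple of its
    equation. *)
Lemma adj_kernel (A : 'End(U)) (t : K) (c : 'rV_r) :
  let f := vec_in b (c *m \adj (t%:M - endo_mx_in b A)) in
  twact (pure A s) f - pure f (t *: s) =
  \det (t%:M - endo_mx_in b A) *: pure (- vec_in b c) s.
Proof.
move=> f; rewrite twactE (linZ (pureDr _)) -(linZ (pureDl _)) -(linB (pureDl _)).
rewrite -(linZ (pureDl _)); congr pure.
rewrite /f endo_vec_in // -(linZ (vec_in_linear b)) -(linB (vec_in_linear b)).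
rewrite -[- vec_in b c]scaleN1r -!(linZ (vec_in_linear b)); congr vec_in.
rewrite scaleN1r scalerN.
have <- : c *m \adj (t%:M - endo_mx_in b A) *m (t%:M - endo_mx_in b A) =
    \det (t%:M - endo_mx_in b A) *: c.
  by rewrite -mulmxA mul_adj_mx mul_mx_scalar.
by rewrite mulmxBr mul_mx_scalar opprB.
Qed.

Lemma commutator_vec_in (W' : vectType K) (A A' : 'End(U)) (l : W') c :
  twactl (pure A' l) (twact (pure A s) (vec_in b c)) -
  twactr (pure A s) (twact (pure A' l) (vec_in b c)) =
  pure (vec_in b (c *m (endo_mx_in b A *m endo_mx_in b A' -
                        endo_mx_in b A' *m endo_mx_in b A))) (pure s l).
Proof.
rewrite !twactE twactlE twactrE -(linB (pureDl _)); congr pure.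
by rewrite !endo_vec_in // -(linB (vec_in_linear b)) mulmxBr !mulmxA.
Qed.

Lemma endo_mx_in_commute (A A' : 'End(U)) :
  endo_mx_in b A *m endo_mx_in b A' - endo_mx_in b A' *m endo_mx_in b A = 0 ->
  (A \o A' = A' \o A)%VF.
Proof.
move=> N0; apply/eqP; rewrite eq_sym -subr_eq0; apply/eqP; apply: (endo_mx_in_eq0 bb).
by rewrite (linB (endo_mx_in_linear b)) !endo_mx_in_comp.
Qed.

End SpectralAlgebra.

(** A linear form on U (x) (W (x) W') that reads off a coordinate of [u] in
    [pure u (pure s l)]. *)
Definition pure_coord (K : fieldType) (U W W' : vectType K) r (b : r.-tuple U)
    (s : 1.-tuple W) (l : 1.-tuple W') (j : 'I_r) (t : tens U (tens W W')) : K :=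
  coord b j (Defs.contract (fun z => coord s ord0 (Defs.contract (coord l ord0) z)) t).

Lemma pure_coord_linear (K : fieldType) (U W W' : vectType K) r (b : r.-tuple U)
    (s : 1.-tuple W) (l : 1.-tuple W') (j : 'I_r) :
  linear (pure_coord b s l j : tens U (tens W W') -> K^o).
Proof. by move=> a t u; rewrite /pure_coord contract_linear linearP. Qed.

Lemma pure_coordE (K : fieldType) (U W W' : vectType K) r (b : r.-tuple U)
    (s : W) (l : W') (j : 'I_r) (u : U) :
  basis_of {:W} [tuple of [:: s]] -> basis_of {:W'} [tuple of [:: l]] ->
  pure_coord b [tuple of [:: s]] [tuple of [:: l]] j (pure u (pure s l)) = coord b j u.
Proof.
move=> bs bl; rewrite /pure_coord contractE; last first.
  by move=> a t v; rewrite contract_linear linearP.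
rewrite contractE; last exact: coord_linear.
by rewrite !linearZ /= !line_coord1 // /GRing.scale /= !mul1r.
Qed.

(** Under a linear form with value [a] on the generator, a field and a point of the
    total space become [a *: A] and [a * m]; the powers of their difference are
    rescaled by powers of [a]. *)
Lemma vec_in_iter (K : fieldType) (U : vectType K) r (b : r.-tuple U) (A : 'End(U))
    (a m : K) d c : basis_of {:U} b ->
  iter d (fun v => a *: A v - (a * m) *: v) (vec_in b c) =
  a ^+ d *: vec_in b (iter d (fun c => c *m endo_mx_in b A - m *: c) c).
Proof.
move=> bb; elim: d => [|d IH]; first by rewrite expr0 scale1r.
rewrite !iterS IH !linearZ /= (endo_vec_in _ _ bb).
set c' := iter d _ c.
rewrite (linD (vec_in_linear b)) (linZ (vec_in_linear b)) -(scaleN1r c').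
rewrite (linZ (vec_in_linear b)) scaleN1r exprSr scalerDr !scalerA.
by congr (_ + _ *: _); rewrite mulrC mulrA.
Qed.

(** A coordinate in T of a coordinate in U of the residue is a row times a fixed
    matrix, the form in which [gen_eigen_span] applies. *)
Lemma residue_coord (K : fieldType) (U T : vectType K) r (b : r.-tuple U) n
    (a : n.-tuple T) (A A' : 'End(U)) (t t' : T) c o k : basis_of {:U} b ->
  pure (A (vec_in b c)) t + pure (A' (vec_in b c)) t' = 0 ->
  (c *m (coord a k t *: endo_mx_in b A + coord a k t' *: endo_mx_in b A')) 0 o = 0.
Proof.
move=> bb /(congr1 (fun z => coord a k (cocontract (coord b o) z))).
rewrite (linD (@cocontract_linear _ _ _ _)) (lin0 (@cocontract_linear _ _ _ _)).
rewrite !(cocontractE _ _ (@coord_linear _ _ _ _ _)).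
rewrite !(endo_vec_in _ _ bb) !(coord_vec_in _ _ bb) linear0 linearD !linearZ /= => <-.
by rewrite mulmxDr -!scalemxAr !mxE mulrC [in X in _ + X]mulrC.
Qed.

(** * Divisibility by the characteristic polynomial *)
Section MatrixPolynomials.
Variable K : numClosedFieldType.

Lemma horner_cts (F : numFieldType) (p : {poly F}) (x : F) :
  {for x, continuous (horner p)}.
Proof.
apply: differentiable_continuous; elim/poly_ind: p => [|p c IH].
  have -> : horner 0 = (fun=> 0) :> (F -> F) by apply/funext => t; rewrite horner0.
  exact: differentiable_cst.
have -> : horner (p * 'X + c%:P) = (fun t => p.[t] * t + c).
  by apply/funext => t; rewrite hornerMXaddC.
apply: differentiableD; last exact: differentiable_cst.
by apply: differentiableM => //; apply/derivable1_diffP; exact: derivable_id.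
Qed.

Lemma dnbhs_neq (F : numFieldType) (a x : F) : \forall t \near x^', t != a.
Proof.
have [<-|xa] := eqVneq x a; first exact: nbhs_dnbhs_neq.
apply: nbhs_dnbhs.
have cx : {for x, continuous (horner ('X - a%:P))} by exact: horner_cts.
have xa0 : ('X - a%:P).[x] != 0 by rewrite hornerXsubC subr_eq0.
have : \forall t \near x, ('X - a%:P).[t] != 0 by exact: (cvgr_neq0 _ cx xa0).
by apply: filterS => t; rewrite hornerXsubC subr_eq0.
Qed.

(** Induction on the degree: at a root [m] of [p] the hypothesis forces [u] to
    vanish, and dividing both by X - m preserves the hypothesis because the quotient
    is only prescribed on punctured neighbourhoods. *)
Lemma dvdp_of_local_quotients (p u : {poly K}) : p != 0 ->
  (forall m, root p m -> exists h : K -> K, {for m, continuous h} /\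
     \forall t \near m^', u.[t] = p.[t] * h t) ->
  p %| u.
Proof.
have [n] := ubnP (size p); elim: n p u => // n IH p u pn p0 H.
have [sp1|sp1] := eqVneq (size p) 1%N.
  by move: sp1 => /eqP; rewrite size_poly_eq1 => /eqp_dvdl ->; exact: dvd1p.
have [m pm] := closed_rootP _ sp1.
have [h [hc hE]] := H m pm.
have um : root u m.
  apply/rootP.
  have cu : horner u t @[t --> m^'] --> u.[m].
    by apply: cvg_within_filter; exact: horner_cts.
  apply: (cvg_unique _ cu); first exact: norm_hausdorff.
  have cp : (p.[t] * h t) @[t --> m^'] --> p.[m] * h m.
    have cph : {for m, continuous (fun t => p.[t] * h t)}.
      by apply: continuousM; [exact: horner_cts | exact: hc].
    by apply: cvg_within_filter; exact: cph.
  rewrite (rootP pm) mul0r in cp.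
  apply: cvg_trans cp; apply: near_eq_cvg; near=> t.
  by apply/esym; near: t.
have /factor_theorem[p' pE] := pm; have /factor_theorem[u' uE] := um.
have p'0 : p' != 0 by apply: contraNneq p0 => p'0; rewrite pE p'0 mul0r.
rewrite pE uE dvdp_mul2r ?polyXsubC_eq0 //.
apply: IH => //.
  by move: pn; rewrite pE size_Mmonic ?monicXsubC // size_XsubC addn2 /=.
move=> v p'v; have [|h' [hc' hE']] := H v; first by rewrite pE rootM p'v.
exists h'; split => //; near=> t.
have tm : t - m != 0 by rewrite subr_eq0; near: t; exact: dnbhs_neq.
apply: (mulIf tm); rewrite mulrAC.
have : u.[t] = p.[t] * h' t by near: t.
by rewrite pE uE !hornerM hornerXsubC.
Unshelve. all: by end_near. Qed.

Lemma size_det (n : nat) (A : 'M[{poly K}]_n) :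
  (forall i j, (size (A i j) <= 2)%N) -> (size (\det A) <= n.+1)%N.
Proof.
move=> A2; apply: leq_trans (size_sum _ _ _) _; apply/bigmax_leqP => s _.
rewrite -signr_odd mulr_sign (fun_if (fun p : {poly K} => size p)) size_polyN if_same.
apply: leq_trans (size_prod_leq _ _) _.
rewrite leq_subLR -[#|_|]/#|'I_n| card_ord addnS ltnS.
apply: (@leq_trans (\sum_(i < n) 2)%N); first by apply: leq_sum => i _.
by rewrite sum_nat_const card_ord muln2 addnn.
Qed.

Lemma size_adj_char_poly_mx (n : nat) (M : 'M[K]_n) i j :
  (size ((\adj (char_poly_mx M)) i j) <= n)%N.
Proof.
rewrite mxE size_Msign.
case: n M i j => [M [] //|n M i j].
apply: size_det => a b; rewrite !mxE.
apply: leq_trans (size_polyD _ _) _; rewrite geq_max size_polyN.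
rewrite (leq_trans (size_polyC_leq1 _)) // andbT.
by case: (_ == _); rewrite ?mulr1n ?mulr0n ?size_polyX ?size_poly0.
Qed.

(** The characteristic polynomial has degree [n] and divides the entries of
    adj(X - M) N, whose degree is less than [n]; so adj(X - M) N = 0, and
    multiplication by X - M gives char_poly M times N = 0. *)
Lemma adj_char_poly_dvd_eq0 n (M N : 'M[K]_n) :
  (forall i j m, root (char_poly M) m -> exists h : K -> K, {for m, continuous h} /\
    \forall t \near m^', (\adj (t%:M - M) *m N) i j = \det (t%:M - M) * h t) ->
  N = 0.
Proof.
move=> H.
pose P : 'M[{poly K}]_n := \adj (char_poly_mx M) *m map_mx polyC N.
have ev t : map_mx (horner_eval t) (char_poly_mx M) = t%:M - M.
  apply/matrixP=> i j; rewrite !mxE /= /horner_eval.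
  by rewrite hornerD hornerN hornerC hornerMn hornerX.
have PE t i j : (P i j).[t] = (\adj (t%:M - M) *m N) i j.
  rewrite -ev -map_mx_adj -horner_evalE !mxE rmorph_sum; apply: eq_bigr => k _.
  by rewrite rmorphM /= !mxE /= /horner_eval hornerC.
have P0 : P = 0.
  apply/matrixP=> i j; rewrite [RHS]mxE; apply/eqP; apply: contraT => Pij.
  have cp0 : char_poly M != 0 by rewrite monic_neq0 // char_poly_monic.
  have /dvdp_leq : char_poly M %| P i j.
    apply: dvdp_of_local_quotients => // m /(H i j)[h [hc hE]]; exists h; split => //.
    by apply: filterS hE => t; rewrite PE char_poly_horner.
  move=> /(_ Pij); rewrite size_char_poly leqNgt ltnS.
  rewrite mxE; apply: contraNT => _; apply: leq_trans (size_sum _ _ _) _.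
  apply/bigmax_leqP => k _; rewrite !mxE mulrC mul_polyC.
  apply: leq_trans (size_scale_leq _ _) _.
  by have := size_adj_char_poly_mx M i k; rewrite mxE.
have : char_poly_mx M *m P = 0 by rewrite P0 mulmx0.
rewrite mulmxA mul_mx_adj mul_scalar_mx => N0.
apply/matrixP=> i j; move/matrixP/(_ i j)/eqP: N0; rewrite !mxE mulf_eq0.
by rewrite (negPf (monic_neq0 (char_poly_monic M))) /= polyC_eq0 => /eqP.
Qed.

(** Split a root [m] off a divisor of the characteristic polynomial: Bezout writes
    every vector killed by q (X - m)^d as a generalized eigenvector plus a vector
    killed by [q].  Cayley-Hamilton starts the induction. *)
Lemma gen_eigen_span r k (M : 'M[K]_r) (N : 'M[K]_(r, k)) :
  (forall m d (c : 'rV_r), root (char_poly M) m ->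
     iter d (fun c => c *m M - m *: c) c = 0 -> c *m N = 0) -> N = 0.
Proof.
case: r M N => [|r] M N H; first exact: flatmx0.
have iterE m d c : iter d (fun c => c *m M - m *: c) c =
    c *m horner_mx M (('X - m%:P) ^+ d).
  elim: d => [|d IH]; first by rewrite expr0 rmorph1 mulmx1.
  rewrite iterS IH exprSr rmorphM /= rmorphB /= horner_mx_X horner_mx_C.
  by rewrite -mul_mx_scalar -mulmxBr -mulmxA.
suff Hp p (c : 'rV_r.+1) : p != 0 -> p %| char_poly M ->
    c *m horner_mx M p = 0 -> c *m N = 0.
  apply/row_matrixP => i; rewrite row0 rowE; apply: (Hp (char_poly M)) => //.
    by rewrite monic_neq0 // char_poly_monic.
  by rewrite Cayley_Hamilton mulmx0.
have [n] := ubnP (size p); elim: n p c => // n IH p c pn p0 pM cp.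
have [sp1|sp1] := eqVneq (size p) 1%N.
  move: sp1 cp => /eqP/size_poly1P[a a0 ->].
  rewrite horner_mx_C mul_mx_scalar => /eqP.
  by rewrite scaler_eq0 (negPf a0) => /eqP ->; rewrite mul0mx.
have [m pm] := closed_rootP _ sp1.
have [d [q qm pE]] := multiplicity_XsubC p m.
rewrite p0 /= in qm.
have d0 : (0 < d)%N.
  by case: d pE => // pE; move: pm; rewrite pE expr0 mulr1 (negPf qm).
have cop : coprimep q (('X - m%:P) ^+ d).
  by rewrite coprimep_expr // coprimep_XsubC.
have [[u v] /= uv] := Bezout_eq1_coprimepP _ _ cop.
(* the first summand is killed by (X - m)^d, the second by q *)
have -> : c = c *m horner_mx M (u * q) + c *m horner_mx M (v * ('X - m%:P) ^+ d).
  by rewrite -mulmxDr -rmorphD /= uv rmorph1 mulmx1.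
have q0 : q != 0 by apply: contraNneq p0 => q0; rewrite pE q0 mul0r.
have hM f g : c *m horner_mx M (f * g) = c *m horner_mx M f *m horner_mx M g.
  by rewrite rmorphM /= mulmxA.
have kill f : p %| f -> c *m horner_mx M f = 0.
  by move=> /dvdpP[g ->]; rewrite mulrC hM cp mul0mx.
rewrite mulmxDl (H m d) ?(IH q) ?addr0 //.
- move: pn; rewrite pE size_Mmonic ?monic_exp ?monicXsubC // size_exp_XsubC.
  rewrite addnS /= ltnS; apply: leq_trans.
  by rewrite -addn1 leq_add2l.
- by apply: dvdp_trans pM; rewrite pE dvdp_mulr.
- by rewrite -hM kill // pE -mulrA [_ * q]mulrC dvdp_mull.
- by rewrite -dvdp_XsubCl; apply: dvdp_trans pM; rewrite dvdp_XsubCl.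
- by rewrite iterE -hM kill // pE -mulrA dvdp_mull.
Qed.

End MatrixPolynomials.

(** * Holomorphic functions on the surface and on the total space *)
Lemma differentiable_fst (K : numFieldType) (U V : normedModType K) (w : U * V) :
  differentiable (@fst U V) w.
Proof. by apply: linear_differentiable => u; exact: cvg_fst. Qed.

Lemma differentiable_snd (K : numFieldType) (U V : normedModType K) (w : U * V) :
  differentiable (@snd U V) w.
Proof. by apply: linear_differentiable => u; exact: cvg_snd. Qed.

Lemma differentiable_bigsum (K : numFieldType) (V : normedModType K) (I : Type)
    (q : seq I) (f : I -> V -> K) x :
  (forall i, differentiable (f i) x) -> differentiable (fun y => \sum_(i <- q) f i y) x.
Proof.
move=> hf; elim: q => [|i q IH].
  by under eq_fun do rewrite big_nil; exact: differentiable_cst.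
by under eq_fun do rewrite big_cons; exact: differentiableD (hf i) IH.
Qed.

Lemma near_fibre (K : numFieldType) (z m : K) (P : K * K -> Prop) :
  (\forall w \near (z, m), P w) -> \forall t \near m, P (z, t).
Proof.
move=> hP.
have d : differentiable (fun t : K => (z, t)) m.
  apply: differentiable_pair; first exact: differentiable_cst.
  by apply/derivable1_diffP; exact: derivable_id.
exact: (differentiable_continuous d hP).
Qed.

Section HolomorphicFunctions.
Variables (R : realType) (X : riemann_surface R).
Local Notation C := (Cplx R).
Implicit Types (x : X) (f g : X -> C).

Lemma near_chart x i (P : X -> Prop) : rs_dom i x ->
  (\forall y \near x, P y) -> \forall z \near rs_chart i x, P (rs_inv i z).
Proof.
move=> xi Px; have := @rs_inv_cts _ X i x xi.
by rewrite /prop_for /continuous_at rs_chartK // => /(_ _ Px).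
Qed.

Lemma holo_ext x f g :
  (\forall y \near x, f y = g y) -> holo_at x f -> holo_at x g.
Proof.
move=> fg fx i xi; have := fx i xi; move: (near_chart xi fg) => /near_join.
by apply: filterS2 => z fgz; apply: near_eq_derivable.
Qed.

Lemma holo_cst x (a : C) : holo_at x (fun=> a).
Proof. by move=> i xi; near=> z; exact: derivable_cst. Unshelve. all: by end_near. Qed.

Lemma holoD x f g : holo_at x f -> holo_at x g -> holo_at x (fun y => f y + g y).
Proof.
move=> fx gx i xi; apply: filterS2 (fx i xi) (gx i xi) => z; exact: derivableD.
Qed.

Lemma holoM x f g : holo_at x f -> holo_at x g -> holo_at x (fun y => f y * g y).
Proof.
move=> fx gx i xi; apply: filterS2 (fx i xi) (gx i xi) => z; exact: derivableM.
Qed.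

Lemma holo_sum x (I : Type) (s : seq I) (P : pred I) (F : I -> X -> C) :
  (forall i, holo_at x (F i)) -> holo_at x (fun y => \sum_(i <- s | P i) F i y).
Proof.
move=> Fx; elim: s => [|i s IH].
  by under eq_fun do rewrite big_nil; exact: holo_cst.
under eq_fun do rewrite big_cons.
case: (P i); [exact: holoD (Fx i) IH | exact: IH].
Qed.

Lemma holo_cts x f i : rs_dom i x -> holo_at x f ->
  {for rs_chart i x, continuous (f \o rs_inv i)}.
Proof.
move=> xi fx; apply: differentiable_continuous; apply/derivable1_diffP.
exact: nbhs_singleton (fx i xi).
Qed.

(** In a chart the function is continuous and a point of C is not isolated. *)
Lemma holo_vanish x f : holo_at x f ->
  (\forall y \near x, y <> x -> f y = 0) -> f x = 0.
Proof.
move=> fx f0; have [i xi] := rs_cover x.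
have cf := holo_cts xi fx.
have dom_img : \forall z \near rs_chart i x, (rs_chart i @` rs_dom i) z.
  by apply: open_nbhs_nbhs; split; [exact: rs_img_open | exists x].
rewrite -[x in LHS](rs_chartK xi).
have cf' : (f \o rs_inv i) z @[z --> (rs_chart i x)^'] --> f (rs_inv i (rs_chart i x)).
  exact: cvg_within_filter.
apply: (cvg_unique _ cf'); first exact: norm_hausdorff.
apply: cvg_near_cst; near=> z.
have [y yi yz] : (rs_chart i @` rs_dom i) z.
  by near: z; exact: nbhs_dnbhs.
have zx : z != rs_chart i x by near: z; exact: nbhs_dnbhs_neq.
have : rs_inv i z <> x -> f (rs_inv i z) = 0.
  by near: z; apply: nbhs_dnbhs; exact: near_chart xi f0.
rewrite /= -yz rs_chartK //; apply=> yx.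
by move: zx; rewrite -yz yx eqxx.
Unshelve. all: by end_near. Qed.

End HolomorphicFunctions.

Section TotalSpace.
Variables (R : realType) (X : riemann_surface R) (S : osheaf X).
Local Notation C := (Cplx R).
Implicit Types (p q : Defs.total S) (g h : Defs.total S -> C).

Lemma tot_near_tag p (P : X -> Prop) :
  (\forall y \near tag p, P y) -> tot_near p (fun q => P (tag q)).
Proof.
move=> Px i s tau [pi _ _ _].
have := near_chart pi Px; rewrite /= => Pi.
have c : {for (rs_chart i (tag p), tau), continuous (@fst C C)}.
  by apply: differentiable_continuous; exact: differentiable_fst.
exact: (c _ Pi).
Qed.

Lemma tot_holo_cst p (a : C) : tot_holo p (fun=> a).
Proof.
move=> i s tau _; near=> w; exact: differentiable_cst.
Unshelve. all: by end_near. Qed.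

Lemma tot_holoD p g h : tot_holo p g -> tot_holo p h ->
  tot_holo p (fun q => g q + h q).
Proof.
move=> gp hp i s tau c; apply: filterS2 (gp _ _ _ c) (hp _ _ _ c) => w.
exact: differentiableD.
Qed.

Lemma tot_holoM p g h : tot_holo p g -> tot_holo p h ->
  tot_holo p (fun q => g q * h q).
Proof.
move=> gp hp i s tau c; apply: filterS2 (gp _ _ _ c) (hp _ _ _ c) => w.
exact: differentiableM.
Qed.

Lemma tot_holo_sum p (I : Type) (s : seq I) (P : pred I) (F : I -> Defs.total S -> C) :
  (forall i, tot_holo p (F i)) -> tot_holo p (fun q => \sum_(i <- s | P i) F i q).
Proof.
move=> Fp; elim: s => [|i s IH].
  by under eq_fun do rewrite big_nil; exact: tot_holo_cst.
under eq_fun do rewrite big_cons.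
case: (P i); [exact: tot_holoD (Fp i) IH | exact: IH].
Qed.

Lemma tot_holo_prod p (I : Type) (s : seq I) (P : pred I) (F : I -> Defs.total S -> C) :
  (forall i, tot_holo p (F i)) -> tot_holo p (fun q => \prod_(i <- s | P i) F i q).
Proof.
move=> Fp; elim: s => [|i s IH].
  by under eq_fun do rewrite big_nil; exact: tot_holo_cst.
under eq_fun do rewrite big_cons.
case: (P i); [exact: tot_holoM (Fp i) IH | exact: IH].
Qed.

Lemma tot_holo_tag p (f : X -> C) :
  holo_at (tag p) f -> tot_holo p (fun q => f (tag q)).
Proof.
move=> fx i s tau [pi _ _ _].
have c : {for (rs_chart i (tag p), tau), continuous (@fst C C)}.
  by apply: differentiable_continuous; exact: differentiable_fst.
have fw : \forall w \near (rs_chart i (tag p), tau), derivable (f \o rs_inv i) w.1 1.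
  exact: (c _ (fx i pi)).
near=> w.
have d1 : differentiable (f \o rs_inv i) (fst w).
  by apply/derivable1_diffP; near: w.
exact: (differentiable_comp (differentiable_fst w) d1).
Unshelve. all: by end_near. Qed.

End TotalSpace.

(** * Sections in local frames *)
Section LocalFrames.
Variables (R : realType) (X : riemann_surface R).
Local Notation C := (Cplx R).

(** The frame consists of families over the whole surface, as sections do; only its
    germ at [x] matters. *)
Definition frame_at r (A : osheaf X) (x : X) (e : 'I_r -> forall y, A y) : Prop :=
  (\forall y \near x, basis_of {:A y} [tuple e i y | i < r]) /\
  forall s : forall y, A y, sec x s <->
    forall i, holo_at x (fun y => coord [tuple e j y | j < r] i (s y)).

Lemma bundle_frame r (A : osheaf X) (x : X) : vector_bundle r A ->
  exists e : 'I_r -> forall y, A y, frame_at x e.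
Proof.
move=> /(_ x)[e He]; exists e; split; first by apply: filterS He => y [].
by have [] := nbhs_singleton He.
Qed.

Section OneFrame.
Variables (r : nat) (A : osheaf X) (x : X) (e : 'I_r -> forall y, A y).
Hypothesis fe : frame_at x e.
Local Notation te y := [tuple e i y | i < r].

Lemma frame_basis : \forall y \near x, basis_of {:A y} (te y).
Proof. exact: fe.1. Qed.

Lemma frame_basis_at : basis_of {:A x} (te x).
Proof. exact: nbhs_singleton frame_basis. Qed.

Lemma frame_holo (s : forall y, A y) i : sec x s ->
  holo_at x (fun y => coord (te y) i (s y)).
Proof. by move/fe.2. Qed.

Lemma frame_sec_ext (s t : forall y, A y) :
  (\forall y \near x, s y = t y) -> sec x s -> sec x t.
Proof.
move=> st /fe.2 hs; apply/fe.2 => i; apply: holo_ext (hs i).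
by apply: filterS st => y ->.
Qed.

Lemma frame_secZ (f : X -> C) (s : forall y, A y) : holo_at x f -> sec x s ->
  sec x (fun y => f y *: s y).
Proof.
move=> hf /fe.2 hs; apply/fe.2 => i.
by apply: holo_ext (holoM hf (hs i)); near=> y; rewrite linearZ.
Unshelve. all: by end_near. Qed.

Lemma frame_sec_sum (I : Type) (q : seq I) (P : pred I) (s : I -> forall y, A y) :
  (forall i, sec x (s i)) -> sec x (fun y => \sum_(i <- q | P i) s i y).
Proof.
move=> hs; apply/fe.2 => j.
apply: holo_ext (@holo_sum _ _ x _ q P (fun i y => coord (te y) j (s i y)) _).
  by near=> y; rewrite linear_sum.
by move=> i; have /fe.2 := hs i; exact.
Unshelve. all: by end_near. Qed.

Lemma frame_sec i : sec x (e i).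
Proof.
apply/fe.2 => j; apply: (@holo_ext _ _ x (fun=> (i == j)%:R)); last exact: holo_cst.
apply: filterS frame_basis => y be.
by rewrite -[in RHS](nth_frame (e ^~ y)) coord_free // (basis_free be).
Qed.

End OneFrame.

Section EndoFrame.
Variables (r : nat) (E : osheaf X) (x : X) (e : 'I_r -> forall y, E y).
Hypothesis fe : frame_at x e.
Local Notation te y := [tuple e i y | i < r].

Lemma endo_holo (A : forall y, 'End(E y)) i j : @sec R X (endo E) x A ->
  holo_at x (fun y => endo_mx_in (te y) (A y) i j).
Proof.
move=> hA; have := frame_holo fe j (hA _ (frame_sec fe i)).
by apply: holo_ext; near=> y; rewrite mxE nth_frame.
Unshelve. all: by end_near. Qed.

Lemma endo_sec (A : forall y, 'End(E y)) :
  (forall i j, holo_at x (fun y => endo_mx_in (te y) (A y) i j)) -> @sec R X (endo E) x A.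
Proof.
move=> hA s hs; apply/fe.2 => j.
apply: holo_ext (@holo_sum _ _ x _ (index_enum _) predT
  (fun i y => coord (te y) i (s y) * endo_mx_in (te y) (A y) i j) _); last first.
  by move=> i; apply: holoM (hA i j); exact: frame_holo.
apply: filterS (frame_basis fe) => y be.
rewrite [in RHS](basis_coord (s y) be) !linear_sum; apply: eq_bigr => i _ /=.
by rewrite !linearZ /= mxE.
Qed.

(** Identity principle for endomorphisms, read off matrix entries by
    [holo_vanish]. *)
Lemma endo_vanish (A : forall y, 'End(E y)) : @sec R X (endo E) x A ->
  (\forall y \near x, y <> x -> A y = 0) -> A x = 0.
Proof.
move=> hA A0; apply: (endo_mx_in_eq0 (frame_basis_at fe)); apply/matrixP=> i j.
rewrite [RHS]mxE.
apply: (@holo_vanish _ _ x (fun y => endo_mx_in (te y) (A y) i j)).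
  exact: endo_holo.
by apply: filterS A0 => y Ay yx; rewrite Ay // mxE lfunE /= linear0.
Qed.

Lemma endo_secB (A B : forall y, 'End(E y)) :
  @sec R X (endo E) x A -> @sec R X (endo E) x B ->
  @sec R X (endo E) x (fun y => A y - B y).
Proof.
move=> hA hB; apply: endo_sec => i j.
have := holoD (endo_holo i j hA) (holoM (holo_cst (-1)) (endo_holo i j hB)).
apply: holo_ext; near=> y.
by rewrite !mxE mulN1r add_lfunE opp_lfunE linearB.
Unshelve. all: by end_near. Qed.

Lemma endo_sec_comp (A B : forall y, 'End(E y)) :
  @sec R X (endo E) x A -> @sec R X (endo E) x B ->
  @sec R X (endo E) x (fun y => (A y \o B y)%VF).
Proof.
move=> hA hB s hs; apply: (frame_sec_ext fe _ (hA _ (hB _ hs))).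
by near=> y; rewrite comp_lfunE.
Unshelve. all: by end_near. Qed.

Lemma contract_sec n (W : osheaf X) (w : 'I_n -> forall y, W y)
    (t : forall y, tensor (endo E) W y) l :
  frame_at x w -> sec x t ->
  @sec R X (endo E) x
    (fun y => Defs.contract (coord [tuple w k y | k < n] l) (t y)).
Proof.
move=> fw [m [a [b [ha hb tE]]]]; apply: endo_sec => i j.
apply: holo_ext (@holo_sum _ _ x _ (index_enum _) predT
  (fun k y => coord [tuple w k y | k < n] l (b k y) * endo_mx_in (te y) (a k y) i j) _);
  last first.
  by move=> k; apply: holoM; [exact: frame_holo | exact: endo_holo].
apply: filterS tE => y ->.
exact/esym/endo_mx_in_contract/coord_linear.
Qed.

End EndoFrame.
End LocalFrames.

(** * Sections of the kernel sheaf on the spectral curve *)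
Section Commutation.
Variables (R : realType) (X : riemann_surface R).
Local Notation C := (Cplx R).

Lemma tot_nearS (S : osheaf X) (p : Defs.total S) (P Q : Defs.total S -> Prop) :
  (forall q, P q -> Q q) -> tot_near p P -> tot_near p Q.
Proof.
by move=> PQ Pp i s t c; apply: filterS (Pp i s t c) => w; exact: PQ.
Qed.

Lemma tot_holo_det (S : osheaf X) (p : Defs.total S) n (N : Defs.total S -> 'M[C]_n) :
  (forall i j, tot_holo p (fun q => N q i j)) -> tot_holo p (fun q => \det (N q)).
Proof.
move=> hN; rewrite /determinant; apply: tot_holo_sum => s.
by apply: tot_holoM; [exact: tot_holo_cst | apply: tot_holo_prod].
Qed.

Lemma tot_holo_adj (S : osheaf X) (p : Defs.total S) n (N : Defs.total S -> 'M[C]_n) i j :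
  (forall i j, tot_holo p (fun q => N q i j)) -> tot_holo p (fun q => (\adj (N q)) i j).
Proof.
move=> hN; under eq_fun do rewrite mxE.
apply: tot_holoM; first exact: tot_holo_cst.
by apply: tot_holo_det => a c; under eq_fun do rewrite !mxE; exact: hN.
Qed.

(** The rank one case of [frame_at] with the singleton tuple by which [spec_eq]
    trivializes S. *)
Definition line_frame (A : osheaf X) (x : X) (s : forall y, A y) : Prop :=
  (\forall y \near x, basis_of {:A y} [tuple of [:: s y]]) /\
  forall t : forall y, A y, sec x t <->
    holo_at x (fun y => coord [tuple of [:: s y]] ord0 (t y)).

Lemma bundle_line (A : osheaf X) (x : X) : vector_bundle 1 A ->
  exists s : forall y, A y, line_frame x s.
Proof.
move=> /(bundle_frame x)[s fs]; exists (s ord0).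
split; first by apply: filterS fs.1 => y; rewrite frame1_tuple.
move=> t; split=> [/fs.2/(_ ord0)|h].
  by apply: holo_ext; near=> y; rewrite frame1_tuple.
apply/fs.2 => i; rewrite (ord1 i).
by apply: holo_ext h; near=> y; rewrite frame1_tuple.
Unshelve. all: by end_near. Qed.

Lemma line_frame_at (A : osheaf X) (x : X) (s : forall y, A y) :
  line_frame x s -> frame_at x (fun _ : 'I_1 => s).
Proof.
move=> fs; split; first by apply: filterS fs.1 => y; rewrite frame1_tuple.
move=> t; split=> [/fs.2 h i|/(_ ord0) h].
  by rewrite (ord1 i); apply: holo_ext h; near=> y; rewrite frame1_tuple.
by apply/fs.2; apply: holo_ext h; near=> y; rewrite frame1_tuple.
Unshelve. all: by end_near. Qed.

Lemma line_sec (A : osheaf X) (x : X) (s : forall y, A y) : line_frame x s -> sec x s.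
Proof. by move=> /line_frame_at fs; exact: (frame_sec fs ord0). Qed.

Lemma contract_line r (E W : osheaf X) (x : X) (e : 'I_r -> forall y, E y)
    (s : forall y, W y) (t : forall y, tensor (endo E) W y) :
  frame_at x e -> line_frame x s -> sec x t ->
  @sec R X (endo E) x
    (fun y => Defs.contract (coord [tuple of [:: s y]] ord0) (t y)).
Proof.
move=> fe /line_frame_at fs ht; have := contract_sec fe ord0 fs ht.
by congr (sec x _); apply: functional_extensionality_dep => y; rewrite frame1_tuple.
Qed.

Section SpectralKernel.
Variables (r : nat) (E S : osheaf X) (Theta : forall y, tensor (endo E) S y).
Variables (p : Defs.total S) (e : 'I_r -> forall y, E y) (s : forall y, S y).
Hypothesis (fe : frame_at (tag p) e) (fs : line_frame (tag p) s).
Hypothesis hT : sec (tag p) Theta.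
Local Notation te y := [tuple e i y | i < r].
Local Notation lam y := (coord [tuple of [:: s y]] ord0).
Local Notation M y := (endo_mx_in (te y) (Defs.contract (lam y) (Theta y))).

(** In the chart given by another section [t] of S the tautological coordinate is
    the fibre variable times the holomorphic function t / s. *)
Lemma tot_holo_taut : tot_holo p (fun q => lam (tag q) (tagged q)).
Proof.
move=> i t tau c; have [_ ht _ _] := c.
have /tot_holo_tag/(_ _ _ _ c) := (fs.2 t).1 ht; apply: filterS => w hw.
have -> : (fun q : Defs.total S => lam (tag q) (tagged q)) \o tot_point i t =
    (fun w => w.2 *
      ((fun q : Defs.total S => lam (tag q) (t (tag q))) \o tot_point i t) w).
  by apply/funext => v /=; rewrite linearZ.
by apply: differentiableM => //; exact: differentiable_snd.
Qed.

(** The vector c adj(t - Theta) in the frame [e], [t] being the tautological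
    coordinate. *)
Definition kernel_section (c : 'rV[C]_r) (q : Defs.total S) : E (tag q) :=
  vec_in (te (tag q)) (c *m \adj ((lam (tag q) (tagged q))%:M - M (tag q))).

(** By [adj_kernel], with -(c (x) s) as the quotient by the spectral equation. *)
Lemma kernel_section_in_F c : in_F Theta p (kernel_section c).
Proof.
have hc := endo_holo fe _ _ (contract_line fe fs hT).
split.
  exists r, (fun i q => (c *m \adj ((lam (tag q) (tagged q))%:M - M (tag q))) 0 i), e.
  split; first last.
  - move=> i t tau _; near=> w; rewrite /kernel_section /vec_in.
    by apply: eq_bigr => k _; rewrite nth_frame.
  - exact: frame_sec.
  move=> i; under eq_fun do rewrite mxE.
  apply: tot_holo_sum => k; apply: tot_holoM; first exact: tot_holo_cst.
  apply: tot_holo_adj => a b.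
  under eq_fun do rewrite 2!mxE [X in _ + X]mxE -mulr_natr -mulN1r.
  apply: tot_holoD.
    by apply: tot_holoM; [exact: tot_holo_taut | exact: tot_holo_cst].
  apply: tot_holoM; first exact: tot_holo_cst.
  exact: (tot_holo_tag (f := fun y => M y a b)).
exists s, (fun q => pure (- vec_in (te (tag q)) c) (s (tag q))).
split; first exact: line_sec.
- exact: line_neq0 (nbhs_singleton fs.1).
- exists 1%N, (fun _ _ => 1), (fun _ y => pure (- vec_in (te y) c) (s y)).
  split.
  + by move=> _; exact: tot_holo_cst.
  + move=> _; exists 1%N, (fun _ y => - vec_in (te y) c), (fun _ => s); split.
    * move=> _; apply: (frame_sec_ext fe) (frame_sec_sum fe (index_enum _)
        predT (s := fun i y => - c 0 i *: e i y) _).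
        near=> y; rewrite -scaleN1r scaler_sumr; apply: eq_bigr => i _.
        by rewrite nth_frame scalerA mulN1r.
      move=> i; apply: (frame_secZ fe (f := fun=> - c 0 i)); first exact: holo_cst.
      exact: frame_sec.
    * by move=> _; exact: line_sec.
    * by near=> y; rewrite big_ord1.
  + by move=> i t tau _; near=> w; rewrite big_ord1 scale1r.
have nb : tot_near p (fun q : Defs.total S => basis_of {:E (tag q)} (te (tag q)) /\
    basis_of {:S (tag q)} [tuple of [:: s (tag q)]]).
  exact: (@tot_near_tag _ _ _ p (fun y => basis_of {:E y} (te y) /\
    basis_of {:S y} [tuple of [:: s y]]) (filterI (frame_basis fe) fs.1)).
apply: (tot_nearS _ nb) => -[y v]; rewrite [tag _]/= => -[be bs].
rewrite {1}(line_tens bs (Theta y)) [X in _ - pure _ X](line_coord bs v).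
rewrite (adj_kernel _ be); congr (_ *: _).
rewrite /spec_eq /spec_poly /= (char_poly_line be bs) //; last exact: coord_linear.
by rewrite (line_coord1 bs) expr1n mul1r.
Unshelve. all: by end_near. Qed.

End SpectralKernel.

End Commutation.

(** * Commutation of the two fields *)
Section CommutingFields.
Variables (R : realType) (X : riemann_surface R).
Local Notation C := (Cplx R).

Lemma on_spec_root r (E S : osheaf X) (Theta : forall y, tensor (endo E) S y)
    (x : X) (b : r.-tuple (E x)) (s : S x) (m : C) :
  basis_of {:E x} b -> basis_of {:S x} [tuple of [:: s]] ->
  root (char_poly (endo_mx_in b
    (Defs.contract (coord [tuple of [:: s]] ord0) (Theta x)))) m ->
  on_spec Theta (existT _ x (m *: s)).
Proof.
move=> be bs rm lam _; rewrite /spec_poly (char_poly_line be bs); last first.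
  by move=> ? ? ?; rewrite linearP.
rewrite linearZ /= (line_coord1 bs) /GRing.scale /= mulr1.
by rewrite -char_poly_horner (rootP rm) mulr0.
Qed.

(** Commutation on F is applied to the kernel section of each unit row at each point
    of the spectral curve over [x], and restricted to the fibre of the total space
    over [x]. *)
Lemma commute_at r (E S L : osheaf X) (Theta : forall y, tensor (endo E) S y)
    (Theta' : forall y, tensor (endo E) L y) :
  vector_bundle r E -> vector_bundle 1 S -> vector_bundle 1 L ->
  global_section Theta -> commute_on_F Theta Theta' ->
  forall x, exists (A A' : 'End(E x)) (s : S x) (l : L x),
    [/\ Theta x = pure A s, Theta' x = pure A' l & (A \o A' = A' \o A)%VF].
Proof.
move=> Eb Sb Lb hT comm x.
have [e fe] := bundle_frame x Eb.
have [s fs] := bundle_line x Sb; have [l fl] := bundle_line x Lb.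
have be := frame_basis_at fe.
have bs := nbhs_singleton fs.1; have bl := nbhs_singleton fl.1.
set b := [tuple e i x | i < r] in be.
pose A := Defs.contract (coord [tuple of [:: s x]] ord0) (Theta x).
pose A' := Defs.contract (coord [tuple of [:: l x]] ord0) (Theta' x).
have TE : Theta x = pure A (s x) := line_tens bs (Theta x).
have T'E : Theta' x = pure A' (l x) := line_tens bl (Theta' x).
exists A, A', (s x), (l x); split => //.
suff N0 : endo_mx_in b A *m endo_mx_in b A' - endo_mx_in b A' *m endo_mx_in b A = 0.
  exact: (endo_mx_in_commute be).
apply: (adj_char_poly_dvd_eq0 (M := endo_mx_in b A)) => i j m rm.
pose q t : Defs.total S := existT _ x (t *: s x).
have onq : on_spec Theta (q m) by exact: on_spec_root be bs rm.
have inF := kernel_section_in_F (p := q m) fe fs (hT x) (delta_mx 0 i).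
have [s0 [h0 [_ s00 [n [g [a [hg _ hE]]]] uE]]] := comm (q m) onq _ inF.
have [k kx] := rs_cover x.
have c : tot_coord (q m) k s m.
  by split => //; [exact: line_sec | exact: line_neq0].
have qE t : tot_point k s (rs_chart k x, t) = q t by rewrite /tot_point /= rs_chartK.
pose psi := @pure_coord C (E x) (S x) (L x) _ b
  [tuple of [:: s x]] [tuple of [:: l x]] j.
have psiL : linear (psi : _ -> C^o) by exact: pure_coord_linear.
pose kappa := coord [tuple of [:: s0 x]] ord0 (s x) ^+ r.
(* the quotient by the spectral equation along the fibre; kappa compares the
   trivializations by s and by s0 *)
exists (fun t => kappa * \sum_(o < n) g o (q t) * psi (a o x)); split.
  apply: differentiable_continuous; apply: differentiableM; first exact: differentiable_cst.
  apply: differentiable_bigsum => o; apply: differentiableM; last exact: differentiable_cst.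
  have -> : (fun t => g o (q t)) =
      (g o \o tot_point k s) \o (fun t : C => (rs_chart k x, t)).
    by apply/funext => t /=; rewrite -qE.
  apply: differentiable_comp; last exact: nbhs_singleton (hg o _ _ _ c).
  apply: differentiable_pair; first exact: differentiable_cst.
  by apply/derivable1_diffP; exact: derivable_id.
have hE' := near_fibre (hE _ _ _ c); have uE' := near_fibre (uE _ _ _ c).
apply: nbhs_dnbhs; apply: filterS2 hE' uE' => t; rewrite qE => hEt.
rewrite {}hEt /kernel_section /= TE T'E.
have lamt : coord [tuple of [:: s x]] ord0 (t *: s x) = t.
  by rewrite linearZ /= (line_coord1 bs) /GRing.scale /= mulr1.
have cA : Defs.contract (coord [tuple of [:: s x]] ord0) (pure A (s x)) = A.
  by rewrite -TE.
rewrite lamt cA (commutator_vec_in _ be) => /(congr1 psi).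
rewrite {1}/psi (pure_coordE _ _ _ bs bl) (coord_vec_in _ _ be) -mulmxA -rowE [LHS]mxE.
move=> ->; rewrite (linZ psiL) (linS psiL).
rewrite /spec_eq /spec_poly /= (char_poly_line be bs); last exact: coord_linear.
rewrite lamt -/kappa -/A -scalerA [RHS]mulrCA.
congr (_ * (_ * _)). apply: eq_bigr => o _.
exact: (linZ psiL).
Qed.

End CommutingFields.

(** * The residue condition *)
Section Residue.
Variables (R : realType) (X : riemann_surface R).
Local Notation C := (Cplx R).

(** The residue vanishes on all generalized eigenspaces of [A], hence everywhere; this
    is then read off entry by entry. *)
Lemma residue_entries r (E S L T : osheaf X) (D : set X)
    (Theta : forall y, tensor (endo E) S y) (Theta' : forall y, tensor (endo E) L y)
    (f1 : forall y, 'Hom(S y, T y)) (f2 : forall y, 'Hom(L y, T y))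
    (x : X) (b : r.-tuple (E x)) (s : S x) (l : L x) :
  residue_condition Theta D Theta' f1 f2 -> D x -> basis_of {:E x} b ->
  basis_of {:S x} [tuple of [:: s]] -> basis_of {:L x} [tuple of [:: l]] ->
  let A := Defs.contract (coord [tuple of [:: s]] ord0) (Theta x) in
  let A' := Defs.contract (coord [tuple of [:: l]] ord0) (Theta' x) in
  forall i j, endo_mx_in b A i j *: f1 x s + endo_mx_in b A' i j *: f2 x l = 0.
Proof.
move=> res Dx bb bs bl A A' i j.
have TE : Theta x = pure A s := line_tens bs (Theta x).
have T'E : Theta' x = pure A' l := line_tens bl (Theta' x).
rewrite [LHS](coord_vbasis (memvf _)) big1 // => k _.
suff -> : coord (vbasis {:T x}) k
    (endo_mx_in b A i j *: f1 x s + endo_mx_in b A' i j *: f2 x l) = 0.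
  by rewrite scale0r.
pose phi := coord (vbasis {:T x}) k.
suff : phi (f1 x s) *: endo_mx_in b A + phi (f2 x l) *: endo_mx_in b A' = 0.
  have -> : coord (vbasis {:T x}) k
        (endo_mx_in b A i j *: f1 x s + endo_mx_in b A' i j *: f2 x l) =
      (phi (f1 x s) *: endo_mx_in b A + phi (f2 x l) *: endo_mx_in b A') i j.
    by rewrite linearD !linearZ /= !mxE; congr (_ + _); exact: mulrC.
  by move=> ->; rewrite mxE.
apply: (@gen_eigen_span C _ _ (endo_mx_in b A)) => m d c rm cd.
apply/rowP => o; rewrite [RHS]mxE.
pose y : Defs.total S := existT _ x (m *: s).
have ony : on_spec Theta y := on_spec_root bb bs rm.
have gy : gen_eigen Theta (y := y) (vec_in b c).
  move=> lam; exists d => /=.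
  have -> : Defs.contract lam (Theta x) = lam s *: A.
    by rewrite TE contractE // => ? ? ?; rewrite linearP.
  have -> : (fun v => (lam s *: A) v - lam (m *: s) *: v) =
      (fun v => lam s *: A v - (lam s * m) *: v).
    apply/funext => v; rewrite scale_lfunE; congr (_ - _ *: _).
    by rewrite linearZ; exact: mulrC.
  by rewrite vec_in_iter // cd (lin0 (vec_in_linear b)) scaler0.
have := res y Dx ony _ gy; rewrite /= TE T'E !twactE !tmapE !id_lfunE.
exact: residue_coord.
Qed.

End Residue.

(** * Lifting through the exact sequence *)
Section Lifting.
Variables (R : realType) (X : riemann_surface R).
Local Notation C := (Cplx R).

(** Finite sets are closed in a Hausdorff space. *)
Lemma near_off_finite (D : set X) (x : X) : finite_set D ->
  \forall y \near x, y <> x -> ~ D y.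
Proof.
move=> fD; have cD : closed (D `\ x).
  apply: (accessible_finite_set_closed.1 (hausdorff_accessible (@rs_hausdorff _ X))).
  exact: finite_setD.
have : \forall y \near x, ~ (D `\ x) y.
  by apply: open_nbhs_nbhs; split; [exact: closed_openC | move=> [_]; exact].
by apply: filterS => y nDy yx Dy; apply: nDy.
Qed.

Lemma rho1E (A B1 B2 : osheaf X) (f : forall y, 'Hom(A y, dsum B1 B2 y)) y a :
  rho1 f y a = (f y a).1.
Proof. by rewrite linfunE // => k u v; rewrite linearP. Qed.

Lemma rho2E (A B1 B2 : osheaf X) (f : forall y, 'Hom(A y, dsum B1 B2 y)) y a :
  rho2 f y a = (f y a).2.
Proof. by rewrite linfunE // => k u v; rewrite linearP. Qed.

Lemma xi_split (B1 B2 Q : osheaf X) (g : forall y, 'Hom(dsum B1 B2 y, Q y)) y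
    (b1 : B1 y) (b2 : B2 y) : g y (b1, b2) = xi1 g y b1 + xi2 g y b2.
Proof.
have addE (u v : B1 y * B2 y) : u + v = (u.1 + v.1, u.2 + v.2) by [].
have scaleE a (u : B1 y * B2 y) : a *: u = (a *: u.1, a *: u.2) by [].
rewrite !linfunE; first last.
- by move=> a u v; rewrite -linearP; congr (g y _); rewrite scaleE addE /= scaler0 addr0.
- by move=> a u v; rewrite -linearP; congr (g y _); rewrite scaleE addE /= scaler0 addr0.
by rewrite -linearD addE /= addr0 add0r.
Qed.

Lemma tensor_sec_ext (A B : osheaf X) (x : X) (t u : forall y, tensor A B y) :
  (\forall y \near x, t y = u y) -> sec x t -> sec x u.
Proof.
move=> tu [n [a [b [ha hb tE]]]]; exists n, a, b; split=> //.
by apply: filterS2 tu tE => y <-.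
Qed.

Section ExactSequence.
Variables (V S L T : osheaf X) (D : set X).
Hypotheses (Vb : vector_bundle 2 V) (Sb : vector_bundle 1 S) (Lb : vector_bundle 1 L).
Hypotheses (fD : finite_set D) (Tt : torsion_length_one D T).
Variables (Phi : forall y, 'Hom(V y, dsum S L y)) (xi : forall y, 'Hom(dsum S L y, T y)).
Hypothesis ex : short_exact Phi xi.

Lemma torsion_eq0 y (t : T y) : ~ D y -> t = 0.
Proof.
case: Tt => _ T0 _ /T0/eqP; rewrite dimv_eq0 => /eqP f0.
by apply/eqP; rewrite -memv0 -f0 memvf.
Qed.

(** Near [x] the torsion sheaf is zero, so exactness lifts every section of S + L;
    thus Phi is surjective on the fibre at [x], and the dimensions agree. *)
Lemma off_support x : ~ D x -> exists (g1 : 'Hom(S x, V x)) (g2 : 'Hom(L x, V x)),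
  forall v, g1 (rho1 Phi x v) + g2 (rho2 Phi x v) = v.
Proof.
move=> nDx.
have [v fv] := bundle_frame x Vb.
have [s fs] := bundle_line x Sb; have [l fl] := bundle_line x Lb.
have bs := nbhs_singleton fs.1; have bl := nbhs_singleton fl.1.
have dimE : \dim {:V x} = \dim {:(S x * L x)%type}.
  by rewrite dim_pair (size_basis (frame_basis_at fv)) (size_basis bs) (size_basis bl).
have nT : \forall y \near x, forall t : T y, t = 0.
  apply: filterS (near_off_finite x fD) => y yD t; apply: torsion_eq0.
  have [->//|/eqP yx] := eqVneq y x; exact: yD.
have surj (w : (S x * L x)%type) : exists u, Phi x u = w.
  pose t y : dsum S L y := (coord [tuple of [:: s x]] ord0 w.1 *: s y,
                            coord [tuple of [:: l x]] ord0 w.2 *: l y).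
  have ht : sec x t.
    split; apply: (frame_secZ (line_frame_at _)
      (f := fun=> coord [tuple of [:: _ x]] ord0 _)); try exact: holo_cst.
    - exact: fs.
    - exact: line_sec.
    - exact: fl.
    - exact: line_sec.
  case: ex => _ _ _ mid _.
  have [|a _ /nbhs_singleton aE] := (mid x t ht).1.
    by apply: filterS nT => y; exact.
  exists (a x); rewrite aE /t -(line_coord bs) -(line_coord bl).
  by case: w {t ht aE}.
have k0 := surj_lker0 dimE surj.
pose i1 : 'Hom(S x, dsum S L x) := linfun (fun b => (b, 0)).
pose i2 : 'Hom(L x, dsum S L x) := linfun (fun b => (0, b)).
exists ((Phi x)^-1 \o i1)%VF, ((Phi x)^-1 \o i2)%VF => u.
rewrite !comp_lfunE -linearD rho1E rho2E -[RHS](lker0_lfunK k0); congr (_ _).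
have addE (z w : S x * L x) : z + w = (z.1 + w.1, z.2 + w.2) by [].
have scaleE a (z : S x * L x) : a *: z = (a *: z.1, a *: z.2) by [].
rewrite !linfunE.
- by rewrite addE /= addr0 add0r; case: (Phi x u).
- by move=> a z w; rewrite scaleE addE /= scaler0 addr0.
- by move=> a z w; rewrite scaleE addE /= scaler0 addr0.
Qed.

Section Fields.
Variables (r : nat) (E : osheaf X) (Eb : vector_bundle r E).
Variables (Theta : forall y, tensor (endo E) S y).
Variables (Theta' : forall y, tensor (endo E) L y).
Hypotheses (hT : global_section Theta) (hT' : global_section Theta').

Definition lifts_at (t : forall y, tensor (endo E) V y) y :=
  Theta y = tmap \1%VF (rho1 Phi y) (t y) /\ Theta' y = tmap \1%VF (rho2 Phi y) (t y).

Lemma lift_off_support t u y : ~ D y -> lifts_at t y -> lifts_at u y -> t y = u y.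
Proof.
move=> /off_support[g1 [g2 g]] [t1 t2] [u1 u2].
by rewrite (tens_split (t y) g) (tens_split (u y) g) -t1 -t2 u1 u2.
Qed.

Lemma endo_unit_sec x (e : 'I_r -> forall y, E y) i j : frame_at x e ->
  @sec R X (endo E) x (fun y => endo_unit [tuple e k y | k < r] i j).
Proof.
move=> fe; apply: (endo_sec fe) => k l.
apply: (@holo_ext _ _ x (fun=> (delta_mx i j : 'M[C]_r) k l)); last exact: holo_cst.
by apply: filterS (frame_basis fe) => y be; rewrite endo_mx_in_unit.
Qed.

(** On each entry the residue condition at [x] and the vanishing of the torsion sheaf
    off D allow a lift of the pair of entries by exactness; finitely many entries
    share a neighbourhood. *)
Lemma local_lift x : residue_condition Theta D Theta' (xi1 xi) (xi2 xi) ->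
  exists t, sec x t /\ \forall y \near x, lifts_at t y.
Proof.
move=> res.
have [e fe] := bundle_frame x Eb.
have [s fs] := bundle_line x Sb; have [l fl] := bundle_line x Lb.
pose te y := [tuple e i y | i < r].
pose A y := Defs.contract (coord [tuple of [:: s y]] ord0) (Theta y).
pose A' y := Defs.contract (coord [tuple of [:: l y]] ord0) (Theta' y).
have hA := endo_holo fe _ _ (contract_line fe fs (hT x)).
have hA' := endo_holo fe _ _ (contract_line fe fl (hT' x)).
(* the (i, j) entry of (Theta, Theta') as a section of S + L *)
pose w (ij : 'I_r * 'I_r) y : dsum S L y :=
  (endo_mx_in (te y) (A y) ij.1 ij.2 *: s y, endo_mx_in (te y) (A' y) ij.1 ij.2 *: l y).
have hw ij : sec x (w ij).
  split.
    exact: (frame_secZ (line_frame_at fs) (hA ij.1 ij.2) (line_sec fs)).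
  exact: (frame_secZ (line_frame_at fl) (hA' ij.1 ij.2) (line_sec fl)).
have wx ij : xi x (w ij x) = 0.
  have [Dx|/torsion_eq0 //] := pselect (D x).
  rewrite xi_split !linearZ /=.
  exact: (residue_entries res Dx (frame_basis_at fe) (nbhs_singleton fs.1)
    (nbhs_singleton fl.1)).
case: ex => _ _ _ mid _.
have lift ij : exists2 a, sec x a & \forall y \near x, Phi y (a y) = w ij y.
  apply/(mid x _ (hw ij)).1; apply: filterS (near_off_finite x fD) => y yD.
  have [->//|/eqP/yD/torsion_eq0] := eqVneq y x; exact.
have [a ha aE] := fin_all_exists2 lift.
exists (fun y => lift_tensor (te y) (fun ij => a ij y)); split.
  exists #|{: 'I_r * 'I_r}|, (fun k y => endo_unit (te y) (enum_val k).1 (enum_val k).2),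
    (fun k => a (enum_val k)).
  split; [move=> k; exact: endo_unit_sec | by move=> k; exact: ha | by near=> y].
have {}aE : \forall y \near x, forall ij, Phi y (a ij y) = w ij y.
  exact: filter_forall.
apply: filterS3 (frame_basis fe) (filterI fs.1 fl.1) aE => y be [bs bl] aE.
split.
  rewrite (@tmap_lift_tensor _ _ _ _ _ _ (A y) _ (s y)) //; first exact: line_tens.
  by move=> ij; rewrite rho1E aE.
rewrite (@tmap_lift_tensor _ _ _ _ _ _ (A' y) _ (l y)) //; first exact: line_tens.
by move=> ij; rewrite rho2E aE.
Unshelve. all: by end_near. Qed.

(** The coefficients of the difference on a frame of V vanish off D. *)
Lemma lift_unique t u : global_section t -> global_section u ->
  (forall y, lifts_at t y) -> (forall y, lifts_at u y) -> t = u.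
Proof.
move=> ht hu lt lu; apply: functional_extensionality_dep => x.
have [e fe] := bundle_frame x Eb; have [v fv] := bundle_frame x Vb.
rewrite (tens_basis (t x) (frame_basis_at fv)) (tens_basis (u x) (frame_basis_at fv)).
apply: eq_bigr => k _; congr pure; apply/eqP; rewrite -subr_eq0; apply/eqP.
apply: (endo_vanish fe (endo_secB fe (contract_sec fe k fv (ht x))
  (contract_sec fe k fv (hu x)))).
apply: filterS (near_off_finite x fD) => y yD /yD nDy.
by rewrite (lift_off_support nDy (lt y) (lu y)) subrr.
Qed.

(** Off D the field is A (x) g1 s + A' (x) g2 l with commuting [A] and [A'].  Near
    any point its square is a commutator of two sections of End(E), which vanishes
    off D, tensored with the wedge of a frame of V. *)
Lemma lift_wedge t : commute_on_F Theta Theta' ->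
  global_section t -> (forall y, lifts_at t y) -> forall x, twwedge (t x) = 0.
Proof.
move=> comm ht lt.
have offD y : ~ D y -> twwedge (t y) = 0.
  move=> /off_support[g1 [g2 g]].
  have [A [A' [s [l [TE T'E AA']]]]] := commute_at Eb Sb Lb hT comm y.
  have [t1 t2] := lt y.
  rewrite (tens_split (t y) g) -t1 -t2 TE T'E !tmapE !id_lfunE twwedge2 AA' subrr.
  exact: lin0 (pureDl _).
move=> x.
have [e fe] := bundle_frame x Eb; have [v fv] := bundle_frame x Vb.
pose B k y := Defs.contract (coord [tuple v i y | i < 2] k) (t y).
have hB k : @sec R X (endo E) x (B k) := contract_sec fe k fv (ht x).
have tE y : basis_of {:V y} [tuple v i y | i < 2] ->
    twwedge (t y) = pure ((B ord0 y \o B ord_max y)%VF - (B ord_max y \o B ord0 y)%VF)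
      (Defs.wedge (v ord0 y) (v ord_max y)).
  exact: twwedge_frame.
rewrite (tE x (frame_basis_at fv)).
have := endo_vanish fe (endo_secB fe (endo_sec_comp fe (hB ord0) (hB ord_max))
  (endo_sec_comp fe (hB ord_max) (hB ord0))).
move=> ->; first exact: lin0 (pureDl _).
apply: filterS2 (near_off_finite x fD) (frame_basis fv) => y yD bv /yD/offD.
rewrite tE //; exact: (@wedge_pure_eq0 _ _ _ _ (fun i => v i y)).
Qed.

(** The value at [x] is that of a lift chosen around [x]; nearby, off D, the lifts
    chosen around different points agree. *)
Lemma lift_exists : residue_condition Theta D Theta' (xi1 xi) (xi2 xi) ->
  exists t, global_section t /\ forall y, lifts_at t y.
Proof.
move=> res; have [t ht] := choice (fun x => local_lift x res).
exists (fun x => t x x); split=> [x|y]; last exact: nbhs_singleton (ht y).2.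
apply: tensor_sec_ext (ht x).1.
apply: filterS2 (near_off_finite x fD) (ht x).2 => y yD lx.
have [->//|/eqP/yD nDy] := eqVneq y x.
exact: (lift_off_support nDy lx (nbhs_singleton (ht y).2)).
Qed.

End Fields.
End ExactSequence.
End Lifting.

Theorem theorem3p4 (R : realType) (X : riemann_surface R)
  (X_compact : compact [set: X]) (X_connected : connected [set: X])
  (V S L T : osheaf X) (D : set X)
  (V_bundle : vector_bundle 2 V)
  (S_bundle : vector_bundle 1 S)
  (L_bundle : vector_bundle 1 L)
  (D_finite : finite_set D)
  (T_torsion : torsion_length_one D T)
  (Phi : forall x : X, 'Hom(V x, dsum S L x))
  (xi : forall x : X, 'Hom(dsum S L x, T x))
  (Phi_xi_exact : short_exact Phi xi)
  (xi1_inj : forall x, D x -> injective (xi1 xi x))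
  (xi2_inj : forall x, D x -> injective (xi2 xi x))
  (r : nat) (E : osheaf X) (E_bundle : vector_bundle r E)
  (Theta : forall x : X, tensor (endo E) S x)
  (Theta_holo : global_section Theta)
  (Theta' : forall x : X, tensor (endo E) L x)
  (Theta'_holo : global_section Theta')
  (cond1 : preserves_F Theta Theta')
  (cond2 : commute_on_F Theta Theta')
  (cond3 : residue_condition Theta D Theta' (xi1 xi) (xi2 xi)) :
  exists! theta : forall x : X, tensor (endo E) V x,
    [/\ higgs_field theta,
        forall x, Theta x = tmap \1%VF (rho1 Phi x) (theta x) &
        forall x, Theta' x = tmap \1%VF (rho2 Phi x) (theta x)].
Proof.
have [theta [htheta lt]] := lift_exists V_bundle S_bundle L_bundle D_finite T_torsion
  Phi_xi_exact E_bundle Theta_holo Theta'_holo cond3.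
exists theta; split=> [|theta' [[htheta' _] eq1 eq2]].
  split=> [|x|x]; [split=> // | exact: (lt x).1 | exact: (lt x).2].
  exact: (lift_wedge V_bundle S_bundle L_bundle D_finite T_torsion Phi_xi_exact E_bundle
    Theta_holo cond2 htheta lt).
exact: (lift_unique V_bundle S_bundle L_bundle D_finite T_torsion Phi_xi_exact E_bundle
  htheta htheta' lt (fun y => conj (eq1 y) (eq2 y))).
Qed.
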